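(* Let $\Lambda$ be an Artin algebra such that $\mathcal{P}^\infty(\Lambda\text{-mod})$ is contravariantly finite in $\Lambda\text{-mod}$. Then $$\mathrm{fin.dim}\,\Lambda = \mathrm{Fin.dim}\,\Lambda ,$$ i.e. the left little finitistic dimension of $\Lambda$ equals the left big finitistic dimension of $\Lambda$.
   Context: $\Lambda\text{-Mod}$ is the category of all left $\Lambda$-modules and $\Lambda\text{-mod}$ the category of finitely generated left $\Lambda$-modules. $\mathcal{P}^\infty(\Lambda\text{-mod})$ and $\mathcal{P}^\infty(\Lambda\text{-Mod})$ are the full subcategories of $\Lambda\text{-mod}$ and $\Lambda\text{-Mod}$, respectively, consisting of the modules of finite projective dimension. The left little finitistic dimension $\mathrm{fin.dim}\,\Lambda$ is the supremum of the projective dimensions of the objects of $\mathcal{P}^\infty(\Lambda\text{-mod})$; the left big finitistic dimension $\mathrm{Fin.dim}\,\Lambda$ is the supremum of the projective dimensions of the objects of $\mathcal{P}^\infty(\Lambda\text{-Mod})$. A full subcategory $\mathcal{A}$ of $\Lambda\text{-mod}$ is contravariantly finite in $\Lambda\text{-mod}$ if for every $M\in\Lambda\text{-mod}$ there are $A\in\mathcal{A}$ and a homomorphism $f:A\to M$ such that every homomorphism $B\to M$ with $B\in\mathcal{A}$ factors through $f$. *)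

(* Defs.v *)
(* Dimensions take values in the extended reals over the R of Stdlib. *)
From mathcomp Require Import all_boot all_order all_algebra.
From mathcomp Require Import all_classical reals ereal Rstruct.

Set Implicit Arguments.
Unset Strict Implicit.
Unset Printing Implicit Defensive.

Import Order.TTheory GRing.Theory Num.Theory.
Local Open Scope ring_scope.
Local Open Scope classical_set_scope.

Definition is_ideal (k : comPzRingType) (I : set k) : Prop :=
  [/\ I 0, forall x y, I x -> I y -> I (x + y) & forall a x, I x -> I (a * x)].

Definition artinian (k : comPzRingType) : Prop :=
  forall I : nat -> set k,
    (forall n, is_ideal (I n)) -> (forall n, I n.+1 `<=` I n) ->
    exists N, forall n, (N <= n)%N -> I n = I N.

(* A k-algebra is given by its structure map k -> Lambda with central image:
   [algType k] would exclude the zero ring. The last clause says that Lambda is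
   finitely generated as a k-module (k acting by c . x = phi c * x). *)
Definition artin_algebra (Lambda : pzRingType) : Prop :=
  exists (k : comPzRingType) (phi : {rmorphism k -> Lambda}),
    [/\ artinian k,
        forall c x, phi c * x = x * phi c &
        exists (n : nat) (g : 'I_n -> Lambda), forall x,
          exists c : 'I_n -> k, x = \sum_(i < n) phi (c i) * g i].

Section Modules.
Variable Lambda : pzRingType.

Definition finitely_generated (M : lmodType Lambda) : Prop :=
  exists (n : nat) (g : 'I_n -> M), forall x,
    exists c : 'I_n -> Lambda, x = \sum_(i < n) c i *: g i.

Definition surjective_map (A B : Type) (f : A -> B) : Prop :=
  forall y, exists x, f x = y.

Definition projective (P : lmodType Lambda) : Prop :=
  forall (A B : lmodType Lambda) (g : {linear A -> B}) (f : {linear P -> B}),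
    surjective_map g -> exists h : {linear P -> A}, forall x, g (h x) = f x.

(* M has a projective resolution of length at most n:
   ... -> 0 -> P_n -> ... -> P_1 -> P_0 -> M -> 0. *)
Definition has_proj_resolution (M : lmodType Lambda) (n : nat) : Prop :=
  exists (P : nat -> lmodType Lambda)
         (d : forall i, {linear P i.+1 -> P i})
         (eps : {linear P 0%N -> M}),
    (forall i, projective (P i)) /\
    surjective_map eps /\
    (forall x, eps x = 0 <-> exists y, d 0%N y = x) /\
    (forall i x, d i x = 0 <-> exists y, d i.+1 y = x) /\
    (forall i, (n < i)%N -> forall x : P i, x = 0).

(* +oo when there is no finite resolution; the zero module gets 0. *)
Definition proj_dim (M : lmodType Lambda) : \bar Rdefinitions.R :=
  ereal_inf [set n%:R%:E | n in [set n : nat | has_proj_resolution M n]].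

(* Full subcategories of Lambda-Mod are represented by predicates on objects. *)
Definition Pinf_Mod (M : lmodType Lambda) : Prop := (proj_dim M < +oo)%E.

Definition Pinf_mod (M : lmodType Lambda) : Prop :=
  finitely_generated M /\ (proj_dim M < +oo)%E.

Definition fin_dim : \bar Rdefinitions.R :=
  ereal_sup [set p | exists M, Pinf_mod M /\ p = proj_dim M].

Definition Fin_dim : \bar Rdefinitions.R :=
  ereal_sup [set p | exists M, Pinf_Mod M /\ p = proj_dim M].

(* C is meant to be contained in Lambda-mod. *)
Definition contravariantly_finite (C : lmodType Lambda -> Prop) : Prop :=
  forall M : lmodType Lambda, finitely_generated M ->
    exists (A : lmodType Lambda) (f : {linear A -> M}), C A /\
      forall (B : lmodType Lambda) (g : {linear B -> M}), C B ->
        exists h : {linear B -> A}, forall x, g x = f (h x).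

End Modules.

(* Main.v *)
(* Write P for the class of finitely generated modules of finite projective
   dimension; we may assume that d bounds these dimensions. Let I = Hom_k(Lambda, E)
   be a finitely generated injective cogenerator and T -> I a right approximation
   by P of minimal length.
   - T is Ext-injective in P: given 0 -> T -> X -> C -> 0 with C in P, the map
     T -> I extends to X and then factors through T -> I; by minimality the
     resulting endomorphism of T is bijective, so the sequence splits.
   - Every C in P embeds in some T^n, with cokernel again in P. Hence a sum of
     copies of Lambda has a coresolution of any length by sums of copies of T, with
     Ext-acyclic cosyzygies of projective dimension at most d.
   - An injection between arbitrary sums of copies of T splits on every finite
     partial sum, by the first point, and hence splits, because T has finite length
     over k and so its sums are algebraically compact.
   - Therefore the class of modules with such coresolutions is closed under
     cokernels of injections, up to losing one step of the coresolution. It contains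
     the projectives, hence all modules of finite projective dimension; and a module
     M with an exact sequence 0 -> M -> U -> N -> 0, where U is a sum of copies of T
     and N has projective dimension at most d, has projective dimension at most d. *)
Require Import Defs.
From HB Require Import structures.
From mathcomp Require Import all_boot all_order all_algebra.
From mathcomp Require Import all_classical reals ereal Rstruct.

Set Implicit Arguments.
Unset Strict Implicit.
Unset Printing Implicit Defensive.

Import Order.TTheory GRing.Theory Num.Theory.
Local Open Scope classical_set_scope.
Local Open Scope ring_scope.

(** * Submodules and quotient modules *)

(** The obstacle is the passage from finitely generated to arbitrary modules. Ext-injectivity of [T]
    is tested against modules in [little] only, and the cokernel of an injection between infinite
    sums of copies of [T] need not be one of them. Hence the acyclicity of cosyzygies is recorded
    inside the coresolutions instead of being derived from their size. An object of P embeds in a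
    finite sum of copies of [T] because [I] cogenerates and each of its maps to [I] factors through
    [T]; finite length lets finitely many maps suffice. Coresolutions of every length are kept
    because a module of projective dimension [m] is reached from projectives by [m] successive
    cokernels, each costing one step. The module [E] is a longest [k]-module in whose socle no
    simple module is repeated; a bound on such lengths comes from the finite length of [k], which is
    itself derived from the descending chain condition. *)

Definition is_submod (R : pzRingType) (V : lmodType R) (S : set V) : Prop :=
  S 0 /\ forall a x y, S x -> S y -> S (a *: x + y).

(** Maps and modules are produced by existence statements throughout, so that later proofs see only
    their defining equations and not the packed structures. *)
Lemma linearP_ex (R : pzRingType) (A B : lmodType R) (f : A -> B) :
  linear f -> exists g : {linear A -> B}, forall x, g x = f x.
Proof.
move=> fL; pose m := GRing.isLinear.Build R A B *:%R f fL.
pose g : {linear A -> B} := HB.pack f m.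
by exists g.
Qed.

Section Submodules.
Variables (R : pzRingType) (V : lmodType R).
Implicit Type S : set V.

Lemma submodD S x y : is_submod S -> S x -> S y -> S (x + y).
Proof. by case=> _ SP Sx Sy; rewrite -(scale1r x); apply: SP. Qed.

Lemma submodZ S a x : is_submod S -> S x -> S (a *: x).
Proof. by case=> S0 SP Sx; rewrite -(addr0 (a *: x)); apply: SP. Qed.

Lemma submodN S x : is_submod S -> S x -> S (- x).
Proof. by move=> HS Sx; rewrite -scaleN1r; apply: submodZ. Qed.

Lemma submodB S x y : is_submod S -> S x -> S y -> S (x - y).
Proof. by move=> HS Sx Sy; apply: submodD => //; apply: submodN. Qed.

Section Def.
Variables (S : set V) (HS : is_submod S).

Definition subm_pred : pred V := fun x => `[< S x >].
(** The closure proof is an argument of the type, so that the module instance can be found from the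
    type alone. *)
Definition subm_type of is_submod S : Type := {x : V | subm_pred x}.
Local Notation W := (subm_type HS).

HB.instance Definition _ := [isSub of W for (@sval _ _ : W -> V)].
HB.instance Definition _ := [Choice of W by <:].

Lemma subm_closed : submod_closed subm_pred.
Proof.
split; first by apply/asboolP; case: HS.
by move=> a u v /asboolP Su /asboolP Sv; apply/asboolP; apply HS.2.
Qed.

HB.instance Definition _ :=
  GRing.SubChoice_isSubLmodule.Build R V subm_pred W subm_closed.
End Def.

Lemma sub_exists S : is_submod S ->
  exists (K : lmodType R) (i : {linear K -> V}),
    injective i /\ forall x, S x <-> exists y, i y = x.
Proof.
move=> HS; exists (subm_type HS : lmodType R).
have fL : linear (fun x : subm_type HS => sval x) by [].
have [i Ei] := linearP_ex fL.
exists i; split=> [x y|x]; first by rewrite !Ei; apply: val_inj.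
split=> [Sx|[[y Sy]]]; last by rewrite Ei => <-; apply/asboolP.
by exists (exist _ x (asboolT Sx)); rewrite Ei.
Qed.

Section Quotient.
Variables (S : set V) (HS : is_submod S).

(** Elements of one coset yield equal sets here, so [xget] chooses the same representative for them;
    the quotient becomes a subtype of [V] with its own equality. *)
Definition coset_repr (x : V) : V := xget 0 [set y | S (y - x)].

Lemma coset_reprP x : S (coset_repr x - x).
Proof.
rewrite /coset_repr; case: xgetP => [y -> //|/(_ x)].
by rewrite /= subrr => /(_ HS.1).
Qed.

Lemma coset_repr_eq x y : S (x - y) -> coset_repr x = coset_repr y.
Proof.
move=> Sxy; rewrite /coset_repr; congr (xget _ _).
apply/seteqP; split=> z /= Sz.
  by rewrite -(subrK x z) -addrA; apply: submodD.
rewrite -(subrK y z) -addrA; apply: submodD => //.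
by rewrite -opprB; apply: submodN.
Qed.

Lemma coset_repr_id x : coset_repr (coset_repr x) = coset_repr x.
Proof. by apply: coset_repr_eq; apply: coset_reprP. Qed.

Definition quot_type of is_submod S : Type :=
  {x : V | coset_repr x == x}.
Local Notation Q := (quot_type HS).

HB.instance Definition _ := [isSub of Q for (@sval _ _ : Q -> V)].
HB.instance Definition _ := [Choice of Q by <:].

Definition quot_proj (x : V) : Q :=
  exist _ (coset_repr x) (introT eqP (coset_repr_id x)).

Lemma quot_projP x y : quot_proj x = quot_proj y <-> S (x - y).
Proof.
split=> [/(congr1 val) /= E|Sxy]; last by apply/val_inj/coset_repr_eq.
have := submodB HS (coset_reprP y) (coset_reprP x).
by rewrite -E opprB addrC addrA subrK.
Qed.

Lemma quot_projK (u : Q) : quot_proj (val u) = u.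
Proof. by apply/val_inj/eqP; case: u. Qed.

Definition quot_add (u v : Q) := quot_proj (val u + val v).
Definition quot_opp (u : Q) := quot_proj (- val u).
Definition quot_scale (a : R) (u : Q) := quot_proj (a *: val u).

Lemma quot_addE x y : quot_add (quot_proj x) (quot_proj y) = quot_proj (x + y).
Proof.
apply/quot_projP => /=; rewrite opprD addrACA.
by apply: submodD => //; apply: coset_reprP.
Qed.
Lemma quot_oppE x : quot_opp (quot_proj x) = quot_proj (- x).
Proof.
apply/quot_projP => /=; rewrite -opprD.
by apply: submodN => //; apply: coset_reprP.
Qed.
Lemma quot_scaleE a x : quot_scale a (quot_proj x) = quot_proj (a *: x).
Proof.
apply/quot_projP => /=; rewrite -scalerBr.
by apply: submodZ => //; apply: coset_reprP.
Qed.

Lemma quot_addA : associative quot_add.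
Proof.
move=> u v w; rewrite -(quot_projK u) -(quot_projK v) -(quot_projK w).
by rewrite !quot_addE addrA.
Qed.
Lemma quot_addC : commutative quot_add.
Proof. by move=> u v; rewrite /quot_add addrC. Qed.
Lemma quot_add0 : left_id (quot_proj 0) quot_add.
Proof. by move=> u; rewrite -(quot_projK u) quot_addE add0r. Qed.
Lemma quot_addN : left_inverse (quot_proj 0) quot_opp quot_add.
Proof. by move=> u; rewrite -(quot_projK u) quot_oppE quot_addE addNr. Qed.
HB.instance Definition _ :=
  GRing.isZmodule.Build Q quot_addA quot_addC quot_add0 quot_addN.

Lemma quot_scaleA a b (u : Q) : quot_scale a (quot_scale b u) = quot_scale (a * b) u.
Proof. by rewrite -(quot_projK u) !quot_scaleE scalerA. Qed.
Lemma quot_scale1 : left_id 1 quot_scale.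
Proof. by move=> u; rewrite -(quot_projK u) quot_scaleE scale1r. Qed.
Lemma quot_scaleDr : right_distributive quot_scale +%R.
Proof.
move=> a u v; rewrite -(quot_projK u) -(quot_projK v).
by rewrite /GRing.add /= !(quot_scaleE, quot_addE) scalerDr.
Qed.
Lemma quot_scaleDl (u : Q) : {morph quot_scale^~ u : a b / a + b >-> a + b}.
Proof.
move=> a b; rewrite -(quot_projK u).
by rewrite [in RHS]/GRing.add /= !(quot_scaleE, quot_addE) scalerDl.
Qed.
HB.instance Definition _ := GRing.Zmodule_isLmodule.Build R Q
  quot_scaleA quot_scale1 quot_scaleDr quot_scaleDl.
End Quotient.

Lemma quot_exists S : is_submod S ->
  exists (Q : lmodType R) (q : {linear V -> Q}),
    surjective_map q /\ forall x, q x = 0 <-> S x.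
Proof.
move=> HS; exists (quot_type HS : lmodType R).
have fL : linear (fun x => quot_proj HS x).
  move=> a x y; rewrite -quot_addE -quot_scaleE /=.
  by rewrite [in RHS]/GRing.add /= [in RHS]/GRing.scale.
have [q Eq] := linearP_ex fL.
exists q; split=> [u|x]; first by exists (val u); rewrite Eq quot_projK.
by rewrite Eq -[0]/(quot_proj HS 0) quot_projP subr0.
Qed.

End Submodules.

(** * Short exact sequences *)

Definition ses (R : pzRingType) (A B C : lmodType R)
    (i : {linear A -> B}) (p : {linear B -> C}) : Prop :=
  [/\ injective i, surjective_map p & forall x, p x = 0 <-> exists y, i y = x].

Section Exactness.
Variable R : pzRingType.
Implicit Types A B C E K L P V X : lmodType R.

Lemma linear_inj A B (f : {linear A -> B}) :
  (forall x, f x = 0 -> x = 0) -> injective f.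
Proof.
move=> f0 x y /eqP; rewrite -subr_eq0 -linearB => /eqP /f0 /eqP.
by rewrite subr_eq0 => /eqP.
Qed.

Lemma submod_setT V : is_submod [set: V].
Proof. by []. Qed.

Lemma submod_set1 V : is_submod [set (0 : V)].
Proof. by split=> // a x y /= -> ->; rewrite scaler0 addr0. Qed.

Lemma submod_preimage A B (f : {linear A -> B}) (S : set B) :
  is_submod S -> is_submod (f @^-1` S).
Proof.
move=> HS; split=> [|a x y Sx Sy] /=; first by rewrite linear0; apply: HS.1.
by rewrite linearP; apply: HS.2.
Qed.

Lemma submod_image A B (f : {linear A -> B}) (S : set A) :
  is_submod S -> is_submod (f @` S).
Proof.
move=> HS; split; first by exists 0; [apply: HS.1|rewrite linear0].
move=> a _ _ [x Sx <-] [y Sy <-]; exists (a *: x + y); last by rewrite linearP.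
exact: HS.2.
Qed.

Lemma submodI V (S S' : set V) :
  is_submod S -> is_submod S' -> is_submod (S `&` S').
Proof.
move=> HS HS'; split; first by split; [apply: HS.1|apply: HS'.1].
by move=> a x y [? ?] [? ?]; split; [apply: HS.2|apply: HS'.2].
Qed.

Lemma submod_sum V (S : set V) (J : Type) (r : seq J) (P : pred J) (F : J -> V) :
  is_submod S -> (forall j, P j -> S (F j)) -> S (\sum_(j <- r | P j) F j).
Proof.
move=> HS SF; elim/big_ind: _ => //; first exact: HS.1.
by move=> x y; apply: submodD.
Qed.

Lemma submod_range A B (f : {linear A -> B}) : is_submod (range f).
Proof. exact: (submod_image f (@submod_setT A)). Qed.

Lemma submod_ker A B (f : {linear A -> B}) : is_submod [set x | f x = 0].
Proof. exact: (submod_preimage f (submod_set1 B)). Qed.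

Lemma ses_surj A B C (i : {linear A -> B}) (p : {linear B -> C}) :
  ses i p -> surjective_map p.
Proof. by case. Qed.

Lemma ses_inj A B C (i : {linear A -> B}) (p : {linear B -> C}) :
  ses i p -> injective i.
Proof. by case. Qed.

Lemma ses_comp0 A B C (i : {linear A -> B}) (p : {linear B -> C}) :
  ses i p -> forall x, p (i x) = 0.
Proof. by case=> _ _ H x; apply/H; exists x. Qed.

Lemma ker_exists B C (p : {linear B -> C}) :
  exists A (i : {linear A -> B}), injective i /\
    forall x, p x = 0 <-> exists y, i y = x.
Proof. exact: (sub_exists (submod_ker p)). Qed.

Lemma surj_ses B C (p : {linear B -> C}) :
  surjective_map p -> exists A (i : {linear A -> B}), ses i p.
Proof. by move=> sp; have [A [i [? ?]]] := ker_exists p; exists A, i. Qed.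

Lemma inj_ses A B (i : {linear A -> B}) :
  injective i -> exists C (p : {linear B -> C}), ses i p.
Proof.
move=> ii; have [C [p [sp pE]]] := quot_exists (submod_range i).
exists C, p; split=> // x; rewrite pE; split=> [[y _]|[y]] <-; first by exists y.
by exists y.
Qed.

Lemma linear_factor B C V (q : {linear B -> C}) (f : {linear B -> V}) :
  surjective_map q -> (forall x, q x = 0 -> f x = 0) ->
  exists g : {linear C -> V}, forall x, g (q x) = f x.
Proof.
move=> sq qf; have [s sK] := choice sq.
have fE x : f (s (q x)) = f x.
  by apply/eqP; rewrite -subr_eq0 -linearB qf // linearB /= sK subrr.
have gL : linear (f \o s).
  move=> a x y /=; rewrite -linearP; rewrite -[RHS]fE.
  by congr (f (s _)); rewrite linearP !sK.
have [g gE] := linearP_ex gL.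
by exists g => x; rewrite gE /= fE.
Qed.

Lemma linear_lift A B C (i : {linear A -> B}) (f : {linear C -> B}) :
  injective i -> (forall c, exists a, i a = f c) ->
  exists g : {linear C -> A}, forall c, i (g c) = f c.
Proof.
move=> ii /choice[g gE].
have gL : linear g by move=> a x y; apply: ii; rewrite linearP !gE linearP.
by have [h hE] := linearP_ex gL; exists h => c; rewrite hE gE.
Qed.

Lemma zero_linear A B : exists f : {linear A -> B}, forall x, f x = 0.
Proof. by apply: linearP_ex => a x y; rewrite scaler0 addr0. Qed.

Lemma pair_linear A B C (f : {linear A -> B}) (g : {linear A -> C}) :
  exists h : {linear A -> (B * C)%type}, forall x, h x = (f x, g x).
Proof. by apply: linearP_ex => a x y; rewrite !linearP. Qed.

Lemma copair_linear A B C (f : {linear A -> C}) (g : {linear B -> C}) :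
  exists h : {linear (A * B)%type -> C}, forall x, h x = f x.1 + g x.2.
Proof.
by apply: linearP_ex => a x y /=; rewrite !linearP /= scalerDr addrACA.
Qed.

Lemma inl_linear A B :
  exists f : {linear A -> (A * B)%type}, forall x, f x = (x, 0).
Proof.
have [z zE] := zero_linear A B.
by have [f fE] := pair_linear idfun z; exists f => x; rewrite fE zE.
Qed.

Lemma inr_linear A B :
  exists f : {linear B -> (A * B)%type}, forall x, f x = (0, x).
Proof.
have [z zE] := zero_linear B A.
by have [f fE] := pair_linear z idfun; exists f => x; rewrite fE zE.
Qed.

Lemma prod_ses A B : exists (i : {linear A -> (A * B)%type})
  (p : {linear (A * B)%type -> B}), 
  [/\ ses i p, forall x, i x = (x, 0) & forall x, p x = x.2].
Proof.
have [i iE] := inl_linear A B; exists i, snd.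
split=> //; split=> [x y|y|[x y]].
- by rewrite !iE => -[].
- by exists (0, y).
- split=> /= [->|[z]]; last by rewrite iE => -[].
  by exists x; rewrite iE.
Qed.

Lemma scaler_linear V (v : V) :
  exists f : {linear R^o -> V}, forall a : R, f a = a *: v.
Proof. by apply: linearP_ex => a x y; rewrite scalerDl scalerA. Qed.

Lemma pullback_exists A B C (f : {linear A -> C}) (g : {linear B -> C}) :
  exists E (u : {linear E -> A}) (v : {linear E -> B}),
  [/\ forall x, f (u x) = g (v x),
      forall x, u x = 0 -> v x = 0 -> x = 0 &
      forall a b, f a = g b -> exists x, u x = a /\ v x = b].
Proof.
have [d dE] := copair_linear f (\- g : {linear B -> C}).
have [E [i [ii iE]]] := ker_exists d.
exists E, (fst \o i : {linear E -> A}), (snd \o i : {linear E -> B}).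
split=> [x|x /= u0 v0|a b ab].
- have /iE : exists y, i y = i x by exists x.
  by rewrite dE /= => /eqP; rewrite subr_eq0 => /eqP.
- by apply: ii; rewrite linear0; case: (i x) u0 v0 => /= ? ? -> ->.
- have /iE[x xE] : d (a, b) = 0 by rewrite dE /= ab subrr.
  by exists x; rewrite /= xE.
Qed.

(** Universal property of the pullback, extracted from joint injectivity of [u] and [v]. *)
Lemma joint_lift A B E X (u : {linear E -> A}) (v : {linear E -> B})
    (f : {linear X -> A}) (g : {linear X -> B}) :
  (forall x, u x = 0 -> v x = 0 -> x = 0) ->
  (forall x, exists y, u y = f x /\ v y = g x) ->
  exists h : {linear X -> E}, (forall x, u (h x) = f x) /\
    forall x, v (h x) = g x.
Proof.
move=> uv0 fg; have [i iE] := pair_linear u v; have [j jE] := pair_linear f g.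
have ii : injective i.
  by apply: linear_inj => x; rewrite iE => -[] /uv0 H /H.
have [x|h hE] := linear_lift (f := j) ii.
  by have [y [yf yg]] := fg x; exists y; rewrite iE jE yf yg.
exists h; split=> x; have := hE x; rewrite iE jE.
  by move=> /(congr1 fst).
by move=> /(congr1 snd).
Qed.

Lemma pullback_ses A B C K (f : {linear A -> C}) (k : {linear K -> B})
    (q : {linear B -> C}) :
  ses k q ->
  exists E (u : {linear E -> A}) (v : {linear E -> B}) (k' : {linear K -> E}),
    [/\ ses k' u, forall x, f (u x) = q (v x), forall y, v (k' y) = k y,
        forall x, u x = 0 -> v x = 0 -> x = 0 &
        forall a b, f a = q b -> exists x, u x = a /\ v x = b].
Proof.
move=> [ki sq qE]; have [E [u [v [uv uv0 uvE]]]] := pullback_exists f q.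
have [z zE] := zero_linear K A.
have [y|k' [uk vk]] := joint_lift (f := z) (g := k) uv0.
  by rewrite zE; apply: uvE; rewrite linear0; apply/esym/qE; exists y.
exists E, u, v, k'; split=> //; split.
- by move=> x y xy; apply: ki; rewrite -!vk xy.
- by move=> a; have [b /esym/uvE[x [xa _]]] := sq (f a); exists x.
- move=> x; split=> [ux|[y <-]]; last by rewrite uk zE.
  have /qE[y yE] : q (v x) = 0 by rewrite -uv ux linear0.
  exists y; apply/eqP; rewrite -subr_eq0; apply/eqP; apply: uv0.
    by rewrite linearB uk zE ux subrr.
  by rewrite linearB vk yE subrr.
Qed.

(** [L] is the preimage of [A] in [P], which is why it is an extension of [A] by [K]. *)
Lemma ses_comp A B C K P (i : {linear A -> B}) (p : {linear B -> C})
    (k : {linear K -> P}) (q : {linear P -> B}) :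
  ses i p -> ses k q ->
  exists L (l : {linear L -> P}) (u : {linear K -> L}) (v : {linear L -> A}),
    [/\ ses l (p \o q : {linear P -> C}), ses u v,
        forall x, l (u x) = k x & forall x, i (v x) = q (l x)].
Proof.
move=> [ii sp pE] [ki sq qE].
have spq : surjective_map (p \o q : {linear P -> C}).
  by move=> c; have [b <-] := sp c; have [x <-] := sq b; exists x.
have [L [l sl]] := surj_ses spq; have [li _ lE] := sl.
have [x|u uE] := linear_lift (f := k) li.
  apply/lE; rewrite /= (_ : q (k x) = 0) ?linear0 //.
  by apply/qE; exists x.
have [x|v vE] := linear_lift (f := (q \o l : {linear L -> B})) ii.
  by apply/pE; apply/(lE (l x)); exists x.
exists L, l, u, v; split=> //; split.
- by move=> x y xy; apply: ki; rewrite -!uE xy.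
- move=> a; have [x xE] := sq (i a).
  have /lE[y yE] : (p \o q) x = 0 by rewrite /= xE; apply/pE; exists a.
  by exists y; apply: ii; rewrite vE /= yE.
- move=> x; split=> [vx|[y <-]].
    have /qE[y yE] : q (l x) = 0 by rewrite -[LHS]vE vx linear0.
    by exists y; apply: li; rewrite uE.
  by apply: ii; rewrite vE /= uE linear0; apply/qE; exists y.
Qed.

Lemma splitting_retraction A B C (i : {linear A -> B}) (p : {linear B -> C})
    (s : {linear C -> B}) :
  ses i p -> (forall x, p (s x) = x) ->
  exists r : {linear B -> A},
    (forall x, r (i x) = x) /\ forall x, i (r x) + s (p x) = x.
Proof.
move=> [ii sp pE] sK.
have [|r rE] := @linear_lift A B B i (idfun \- (s \o p)) ii.
  by move=> b; apply/pE; rewrite /= linearB /= sK subrr.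
exists r; split=> x; last by rewrite rE /= subrK.
apply: ii; rewrite rE /=.
have -> : p (i x) = 0 by apply/pE; exists x.
by rewrite linear0 subr0.
Qed.

Lemma retraction_splitting A B C (i : {linear A -> B}) (p : {linear B -> C})
    (r : {linear B -> A}) :
  ses i p -> (forall x, r (i x) = x) ->
  exists s : {linear C -> B}, forall x, p (s x) = x.
Proof.
move=> [ii sp pE] rK.
have pi x : p x = 0 -> (idfun \- (i \o r) : {linear B -> B}) x = 0.
  by move=> /pE[y <-] /=; rewrite rK subrr.
have [s sE] := linear_factor sp pi.
exists s => c; have [b <-] := sp c.
have pir : p (i (r b)) = 0 by apply/pE; exists (r b).
by rewrite sE /= linearB /= pir subr0.
Qed.

End Exactness.

(** * Direct sums of copies of a module *)

Definition finsupp (I : choiceType) (T : zmodType) (t : I -> T) : Prop :=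
  exists s : seq I, forall i, t i <> 0 -> i \in s.

Definition single (I : choiceType) (T : zmodType) (i : I) (x : T) : I -> T :=
  fun j => if j == i then x else 0.

(* [c] exhibits [U] as the direct sum of copies of [T] indexed by [I]. *)
Definition is_dsum (R : pzRingType) (T U : lmodType R) (I : choiceType)
    (c : {linear U -> (I -> T)}) : Prop :=
  injective c /\ forall t, finsupp t <-> exists u, c u = t.

Lemma fct_addE (I : Type) (T : zmodType) (s t : I -> T) i :
  (s + t) i = s i + t i.
Proof. by []. Qed.

Lemma fct_oppE (I : Type) (T : zmodType) (t : I -> T) i : (- t) i = - t i.
Proof. by []. Qed.

Lemma fct_scaleE (R : pzRingType) (I : Type) (T : lmodType R) a (t : I -> T) i :
  (a *: t) i = a *: t i.
Proof. by []. Qed.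

Section Dsum.
Variables (R : pzRingType) (I : choiceType).
Implicit Types T U V : lmodType R.

Lemma finsupp_comb T a (s t : I -> T) :
  finsupp s -> finsupp t -> finsupp (a *: s + t).
Proof.
move=> [u uP] [v vP]; exists (u ++ v) => i; rewrite mem_cat => Hi.
case: (pselect (s i = 0)) => [si|/uP -> //].
case: (pselect (t i = 0)) => [ti|/vP ->]; last by rewrite orbT.
by case: Hi; rewrite fct_addE fct_scaleE si ti scaler0 addr0.
Qed.

Lemma finsupp_single T i (x : T) : finsupp (single i x : I -> T).
Proof.
by exists [:: i] => j; rewrite /single inE; case: eqP.
Qed.

Lemma finsuppW (T T' : zmodType) (s : I -> T) (t : I -> T') :
  finsupp s -> (forall i, s i = 0 -> t i = 0) -> finsupp t.
Proof. by move=> [u uP] st; exists u => i ti; apply: uP => /st. Qed.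

Lemma dsum_exists T : exists U (c : {linear U -> (I -> T)}), is_dsum c.
Proof.
have HS : is_submod [set t : I -> T | finsupp t].
  split; first by exists [::].
  by move=> a s t; apply: finsupp_comb.
have [U [c [ci cE]]] := sub_exists HS.
by exists U, c; split=> // t; apply: cE.
Qed.

Section Elements.
Variables (T U : lmodType R) (c : {linear U -> (I -> T)}).
Hypothesis cS : is_dsum c.

Lemma dsum_finsupp u : finsupp (c u).
Proof. by apply/cS.2; exists u. Qed.

Lemma dsum_single i :
  exists f : {linear T -> U}, forall x, c (f x) = single i x.
Proof.
have sL : linear (fun x : T => single i x).
  move=> a x y; apply/funext => j.
  by rewrite fct_addE fct_scaleE /single; case: eqP; rewrite // scaler0 addr0.
have [s sE] := linearP_ex sL.
have [x|f fE] := linear_lift (f := s) cS.1; last by exists f => x; rewrite fE sE.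
by rewrite sE; apply/cS.2; apply: finsupp_single.
Qed.

Lemma dsum_ind (P : set U) : is_submod P ->
  (forall i x u, c u = single i x -> P u) -> forall u, P u.
Proof.
move=> HP Ps u; have [s] := dsum_finsupp u.
elim: s u => [|i s IH] u us.
  have -> : u = 0; last exact: HP.1.
  apply: cS.1; rewrite linear0; apply/funext => i.
  by apply: contrapT => /us.
have [f fE] := dsum_single i.
rewrite -(subrK (f (c u i)) u); apply: submodD => //; last exact: Ps (fE _).
apply: IH => j; rewrite linearB fE fct_addE fct_oppE /single.
case: eqP => [->|ji]; first by rewrite subrr.
by rewrite subr0 => /us; rewrite inE => /orP[/eqP|].
Qed.

Lemma dsum_lift V (f : I -> {linear T -> V}) :
  exists g : {linear U -> V}, forall i x u, c u = single i x -> g u = f i x.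
Proof.
pose g u := \sum_(i \in [set: I]) f i (c u i).
(* Any list that covers the support computes the sum; this allows three sums to be compared over one
   common list. *)
have gE u (s : seq I) : (forall i, c u i <> 0 -> i \in s) ->
    g u = \sum_(i <- undup s) f i (c u i).
  move=> us; rewrite /g (fsbigE (undup s)) ?undup_uniq //.
    by apply: eq_bigl => i; rewrite in_setT.
  move=> i _; rewrite mem_undup => ni.
  case: (pselect (c u i = 0)) => [->|/us]; first by rewrite linear0.
  by rewrite (negbTE ni).
have gL : linear g.
  move=> a u v; have [s us] := dsum_finsupp u; have [t vt] := dsum_finsupp v.
  have [w uvw] := dsum_finsupp (a *: u + v).
  rewrite (gE _ (s ++ t ++ w)); last by move=> i /uvw h; rewrite !mem_cat h !orbT.
  rewrite (gE u (s ++ t ++ w)); last by move=> i /us h; rewrite !mem_cat h.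
  rewrite (gE v (s ++ t ++ w)); last by move=> i /vt h; rewrite !mem_cat h !orbT.
  rewrite scaler_sumr -big_split /=; apply: eq_bigr => i _.
  by rewrite linearP fct_addE fct_scaleE linearP.
have [h hE] := linearP_ex gL.
exists h => i x u cu; rewrite hE (gE u [:: i]); last first.
  by move=> j; rewrite cu /single inE; case: eqP.
by rewrite /= big_seq1 cu /single eqxx.
Qed.

Lemma dsum_map T' U' (c' : {linear U' -> (I -> T')}) (f : {linear T -> T'}) :
  is_dsum c' ->
  exists g : {linear U -> U'}, forall u i, c' (g u) i = f (c u i).
Proof.
move=> c'S.
have fL : linear (fun u => (fun i => f (c u i)) : I -> T').
  by move=> a u v; apply/funext => i; rewrite linearP fct_addE fct_scaleE linearP.
have [h hE] := linearP_ex fL.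
have [u|g gE] := linear_lift (f := h) c'S.1.
  rewrite hE; apply/c'S.2.
  by apply: finsuppW (dsum_finsupp u) _ => i ->; rewrite linear0.
by exists g => u i; rewrite gE hE.
Qed.

End Elements.

Lemma dsum_ses (K P M : lmodType R) (i : {linear K -> P}) (p : {linear P -> M})
    (UK UP UM : lmodType R) (cK : {linear UK -> (I -> K)}) (cP : {linear UP -> (I -> P)})
    (cM : {linear UM -> (I -> M)}) :
  is_dsum cK -> is_dsum cP -> is_dsum cM -> ses i p ->
  exists (j : {linear UK -> UP}) (q : {linear UP -> UM}),
    [/\ ses j q, forall u x, cP (j u) x = i (cK u x) &
        forall u x, cM (q u) x = p (cP u x)].
Proof.
move=> SK SP SM [ii sp pE].
have [j jE] := dsum_map SK i SP; have [q qE] := dsum_map SP p SM.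
exists j, q; split=> //; split.
- move=> u v uv; apply: SK.1; apply/funext => x; apply: ii.
  by rewrite -!jE uv.
- have [s sK] := choice sp.
  (* The section [s] need not send 0 to 0, so the value 0 is imposed where [cM u] vanishes; this
     keeps the support finite. *)
  move=> u; pose t x := if cM u x == 0 then 0 else s (cM u x).
  have /SP.2[v vE] : finsupp t.
    by apply: finsuppW (dsum_finsupp SM u) _ => x; rewrite /t => ->; rewrite eqxx.
  exists v; apply: SM.1; apply/funext => x; rewrite qE vE /t.
  by case: eqP => [->|_]; rewrite ?linear0.
- move=> u; split=> [qu|[v <-]]; last first.
    apply: SM.1; apply/funext => x; rewrite qE jE linear0.
    by apply/pE; exists (cK v x).
  have pu x : exists y, i y = cP u x.
    by apply/pE; rewrite -qE qu linear0.
  have [s sE] := choice pu.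
  have /SK.2[v vE] : finsupp s.
    apply: finsuppW (dsum_finsupp SP u) _ => x ux.
    by apply: ii; rewrite sE ux linear0.
  by exists v; apply: SP.1; apply/funext => x; rewrite jE vE.
Qed.

End Dsum.

(** * Projective dimension *)

Lemma nat_least (P : nat -> Prop) :
  (exists n, P n) -> exists n, P n /\ forall m, P m -> (n <= m)%N.
Proof.
move=> [n0 Pn0]; have ex : exists n, `[< P n >] by exists n0; apply/asboolP.
case: (ex_minnP ex) => n /asboolP Pn minn.
by exists n; split=> // m Pm; apply: minn; apply/asboolP.
Qed.

Section ProjectiveDimension.
Variable R : pzRingType.
Implicit Types A B C K L P M U V X Y Z : lmodType R.

Definition zero_module M : Prop := forall x : M, x = 0.

Lemma zero_module_exists : exists Z : lmodType R, zero_module Z.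
Proof. by exists ('rV[R]_0 : lmodType R) => x; apply: thinmx0. Qed.

Lemma projective_retract A B (i : {linear A -> B}) (r : {linear B -> A}) :
  (forall x, r (i x) = x) -> projective B -> projective A.
Proof.
move=> rK PB X Y g f sg.
have [h hE] := PB X Y g (f \o r : {linear B -> Y}) sg.
by exists (h \o i : {linear A -> X}) => x; rewrite /= hE /= rK.
Qed.

Lemma projective_prod A B : 
  projective A -> projective B -> projective (A * B)%type.
Proof.
move=> PA PB X Y g f sg.
have [j jE] := inl_linear A B; have [j' jE'] := inr_linear A B.
have [h hE] := PA X Y g (f \o j : {linear A -> Y}) sg.
have [h' hE'] := PB X Y g (f \o j' : {linear B -> Y}) sg.
have [H HE] := copair_linear h h'.
exists H => -[x y]; rewrite HE linearD hE hE' /= jE jE' -linearD.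
by congr (f _); rewrite /GRing.add /= /add_pair /= addr0 add0r.
Qed.

Lemma projective_zero Z : zero_module Z -> projective Z.
Proof.
move=> Z0 X Y g f sg; have [h hE] := zero_linear Z X.
by exists h => x; rewrite (Z0 x) !linear0.
Qed.

Lemma projective_dsum (I : choiceType) P U (c : {linear U -> (I -> P)}) :
  is_dsum c -> projective P -> projective U.
Proof.
move=> cS PP X Y g f sg.
have H i : exists h : {linear P -> X},
    forall x u, c u = single i x -> g (h x) = f u.
  have [j jE] := dsum_single cS i.
  have [h hE] := PP X Y g (f \o j : {linear P -> Y}) sg.
  exists h => x u cu; rewrite hE /=; congr (f _).
  by apply: cS.1; rewrite jE.
have [h hE] := choice H; have [F FE] := dsum_lift cS h.
exists F; apply: (dsum_ind cS (P := [set u | g (F u) = f u])).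
  split=> [|a x y /= xE yE]; first by rewrite /= !linear0.
  by rewrite !linearP xE yE.
by move=> i x u cu /=; rewrite (FE _ _ _ cu); apply: hE.
Qed.

Lemma projective_regular : projective (R^o : lmodType R).
Proof.
move=> X Y g f sg; have [x xE] := sg (f 1).
have [h hE] := scaler_linear x; exists h => a; rewrite hE linearZ xE.
by rewrite -linearZ; congr (f _); rewrite /GRing.scale /= mulr1.
Qed.

(** Projective dimension at most [n], peeling off one syzygy at a time so that proofs can go by
    induction; [proj_dim_le] links it to resolutions. *)
Fixpoint pdle (n : nat) M : Prop :=
  if n is m.+1 then
    exists K P (i : {linear K -> P}) (p : {linear P -> M}),
      [/\ ses i p, projective P & pdle m K]
  else projective M.

Lemma ses_zero_left Z M : zero_module Z ->
  exists z : {linear Z -> M}, ses z (idfun : {linear M -> M}).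
Proof.
move=> Z0; have [z zE] := zero_linear Z M; exists z; split.
- by apply: linear_inj => x _; apply: Z0.
- by move=> x; exists x.
- move=> x /=; split=> [->|[y <-]]; last exact: zE.
  by exists 0; rewrite linear0.
Qed.

Lemma pdle_projective n P : projective P -> pdle n P.
Proof.
elim: n P => [|n IH] P PP //=.
have [Z Z0] := zero_module_exists; have [z zS] := ses_zero_left P Z0.
exists Z, P, z, idfun; split=> //.
by apply: IH; apply: projective_zero.
Qed.

Lemma pdleS n M : pdle n M -> pdle n.+1 M.
Proof.
elim: n M => [|n IH] M; first exact: pdle_projective.
by move=> [K [P [i [p [S PP /IH KE]]]]]; exists K, P, i, p.
Qed.

Lemma pdle_leq m n M : (m <= n)%N -> pdle m M -> pdle n M.
Proof.
move=> /subnK <-; elim: (n - m)%N => //= l IH MM.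
exact/pdleS/IH.
Qed.

Lemma projective_splitting A B P (i : {linear A -> B}) (p : {linear B -> P}) :
  ses i p -> projective P -> exists s : {linear P -> B}, forall x, p (s x) = x.
Proof. by move=> S PP; apply: (PP B P p idfun (ses_surj S)). Qed.

(** Horseshoe argument: a lift of [PC -> C] to [B] makes [PA * PC] cover [B], and the kernel of this
    cover is an extension of [KC] by [KA]. *)
Lemma pdle_ext n A B C (i : {linear A -> B}) (p : {linear B -> C}) :
  ses i p -> pdle n A -> pdle n C -> pdle n B.
Proof.
elim: n A B C i p => [|n IH] A B C i p S /=.
  move=> PA PC; have [s sK] := projective_splitting S PC.
  have [r [_ rsE]] := splitting_retraction S sK.
  have [u uE] := pair_linear r p; have [v vE] := copair_linear i s.
  apply: (projective_retract (i := u) (r := v)); last exact: projective_prod.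
  by move=> x; rewrite vE uE /= rsE.
move=> [KA [PA [kA [qA [SA PPA KAn]]]]] [KC [PC [kC [qC [SC PPC KCn]]]]].
have [l lE] := PPC _ _ p qC (ses_surj S).
have [q qE] := copair_linear (i \o qA : {linear PA -> B}) l.
have [ii sp pE] := S; have [kAi sA AE] := SA; have [kCi sC CE] := SC.
have sq : surjective_map q.
  move=> b; have [y yE] := sC (p b).
  have /pE[a aE] : p (b - l y) = 0 by rewrite linearB lE yE subrr.
  have [x xE] := sA a; exists (x, y).
  by rewrite qE /= xE aE subrK.
have [K [k SK]] := surj_ses sq; have [ki _ kE] := SK.
exists K, (PA * PC)%type, k, q; split=> //; first exact: projective_prod.
have kq x : i (qA (k x).1) + l (k x).2 = 0.
  by rewrite -[LHS](qE (k x)); apply/kE; exists x.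
have [x|v vE] := linear_lift (f := (snd \o k : {linear K -> PC})) kCi.
  apply/CE; rewrite -lE /=; have /(congr1 p) := kq x.
  by rewrite linearD (ses_comp0 S) add0r linear0.
have [j jE] := inl_linear PA PC.
have [x|u uE] := linear_lift (f := (j \o kA : {linear KA -> _})) ki.
  by apply/kE; rewrite qE /= jE /= (ses_comp0 SA) !linear0 addr0.
apply: (IH _ _ _ u v _ KAn KCn); split.
- by move=> x y xy; apply: kAi; have := congr1 (fst \o k) xy; rewrite /= !uE /= !jE.
- move=> z; have /pE[a aE] : p (l (kC z)) = 0 by rewrite lE (ses_comp0 SC).
  have [x xE] := sA a.
  have /kE[y yE] : q (- x, kC z) = 0.
    by rewrite qE /= !linearN xE aE addNr.
  by exists y; apply: kCi; rewrite vE /= yE.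
- move=> x; split=> [vx|[y <-]]; last first.
    by apply: kCi; rewrite vE /= uE /= jE linear0.
  have k2 : (k x).2 = 0 by rewrite -[LHS]vE vx linear0.
  have /AE[y yE] : qA (k x).1 = 0.
    by apply: ii; have := kq x; rewrite k2 linear0 addr0 linear0.
  exists y; apply: ki; rewrite uE /= jE yE -k2.
  by case: (k x).
Qed.

Lemma pdle_prod n A B : pdle n A -> pdle n B -> pdle n (A * B)%type.
Proof. by have [i [p [S _ _]]] := prod_ses A B; apply: pdle_ext S. Qed.

(** The kernel of [P -> B -> C] is an extension of [A] by the syzygy [K] of [B]. *)
Lemma pdle_coker n A B C (i : {linear A -> B}) (p : {linear B -> C}) :
  ses i p -> pdle n A -> pdle n.+1 B -> pdle n.+1 C.
Proof.
move=> S An [K [P [k [q [SK PP Kn]]]]].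
have [L [l [u [v [Sl Suv _ _]]]]] := ses_comp S SK.
exists L, P, l, (p \o q : {linear P -> C}); split=> //.
exact: pdle_ext Suv Kn An.
Qed.

(* If [e] lifts the idempotent [i \o r] of [B] to [P], the kernel of [P -> A] is
   a retract of [K * P] via [x |-> (e x, x)] and [(k, y) |-> k + (y - e y)]. *)
Lemma pdle_retract n A B (i : {linear A -> B}) (r : {linear B -> A}) :
  (forall x, r (i x) = x) -> pdle n B -> pdle n A.
Proof.
elim: n A B i r => [|n IH] A B i r rK; first exact: projective_retract rK.
move=> [K [P [k [p [S PP Kn]]]]]; have [ki sp pE] := S.
have sq : surjective_map (r \o p : {linear P -> A}).
  by move=> a; have [x xE] := sp (i a); exists x; rewrite /= xE rK.
have [L [l Sl]] := surj_ses sq; have [li _ lE] := Sl.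
exists L, P, l, (r \o p : {linear P -> A}); split=> //.
have [e eE] := PP _ _ p (i \o r \o p : {linear P -> B}) sp.
have rl x : r (p (l x)) = 0 by apply/(lE (l x)); exists x.
have [x|f fE] := linear_lift (f := (e \o l : {linear L -> P})) ki.
  by apply/pE; rewrite /= eE /= rl linear0.
have [u uE] := pair_linear f l.
have [x|k' kE'] := linear_lift (f := k) li.
  by apply/lE; rewrite /= (ses_comp0 S) linear0.
have [y|g gE] := linear_lift (f := (idfun \- e : {linear P -> P})) li.
  by apply/lE; rewrite /= !linearB eE /= rK subrr.
have [v vE] := copair_linear k' g.
apply: (IH L (K * P)%type u v); last first.
  by apply: pdle_prod => //; apply: pdle_projective.
move=> x; rewrite vE uE /=; apply: li.
by rewrite linearD kE' fE gE /= addrC subrK.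
Qed.

Lemma pdle_iso n A B (f : {linear A -> B}) :
  injective f -> surjective_map f -> pdle n A -> pdle n B.
Proof.
move=> fi sf; have [g gE] : exists g : {linear B -> A}, forall x, g (f x) = x.
  by apply: (linear_factor (f := idfun) sf) => x /= fx; apply: fi; rewrite fx linear0.
apply: (pdle_retract (i := g) (r := f)) => x.
by have [y <-] := sf x; rewrite gE.
Qed.

(** As in Schanuel's lemma, the pullback [E] of [B] and [P] over [C] is an extension of [B] by [K];
    since [P] is projective, [A] is a retract of [E]. *)
Lemma pdle_ker n A B C (i : {linear A -> B}) (p : {linear B -> C}) :
  ses i p -> pdle n B -> pdle n.+1 C -> pdle n A.
Proof.
move=> S Bn [K [P [k [q [SK PP Kn]]]]].
have [E [u [v [k' [SE uv vk uv0 uvE]]]]] := pullback_ses p SK.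
have En : pdle n E := pdle_ext SE Kn Bn.
have [ii sp pE] := S.
have [l lE] := PP _ _ p q sp.
have [x|g gE] := linear_lift (f := (u \- (l \o v) : {linear E -> B})) ii.
  by apply/pE; rewrite /= linearB lE uv subrr.
have [z zE] := zero_linear A P.
have [x|j [uj vj]] := joint_lift (f := i) (g := z) uv0.
  by rewrite zE; apply: uvE; rewrite (ses_comp0 S) linear0.
apply: (pdle_retract (i := j) (r := g)) En => x.
by apply: ii; rewrite gE /= uj vj zE linear0 subr0.
Qed.

Lemma pdle_dsum (I : choiceType) n M U (c : {linear U -> (I -> M)}) :
  is_dsum c -> pdle n M -> pdle n U.
Proof.
elim: n M U c => [|n IH] M U c cS; first exact: projective_dsum cS.
move=> [K [P [i [p [S PP Kn]]]]].
have [UK [cK SK]] := dsum_exists I K; have [UP [cP SP]] := dsum_exists I P.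
have [j [q [Sjq _ _]]] := dsum_ses SK SP cS S.
exists UK, UP, j, q; split=> //; first exact: projective_dsum SP PP.
exact: IH SK Kn.
Qed.

Lemma resolution_pdle n M : has_proj_resolution M n -> pdle n M.
Proof.
elim: n M => [|n IH] M [P [d [e [PP [se [eE [dE P0]]]]]]].
  apply: (@pdle_iso 0 (P 0%N) M e) => //; last exact: PP.
  apply: linear_inj => x /eE[y <-].
  by rewrite (P0 1%N isT y) linear0.
have [K [i Sie]] := surj_ses se; have [ii _ iE] := Sie.
exists K, (P 0%N), i, e; split=> //.
have [x|e' eE'] := linear_lift (f := d 0%N) ii.
  by apply/iE/eE; exists x.
apply: IH; exists (fun j => P j.+1), (fun j => d j.+1), e'; do ![split] => //.
- move=> x; have /eE[y yE] : e (i x) = 0 by apply/iE; exists x.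
  by exists y; apply: ii; rewrite eE'.
- move=> e0; apply/(dE 0%N); rewrite -eE' e0 linear0 //.
- by move=> /dE xE; apply: ii; rewrite eE' xE linear0.
- by move=> /dE.
- by move=> /dE.
- by move=> j nj; apply: P0.
Qed.

Lemma pdle_resolution n M : pdle n M -> has_proj_resolution M n.
Proof.
elim: n M => [|n IH] M.
  move=> PM; have [Z Z0] := zero_module_exists.
  have [z0 z0E] := zero_linear Z M; have [z zE] := zero_linear Z Z.
  pose T i : lmodType R := if i is j.+1 then Z else M.
  pose D i : {linear T i.+1 -> T i} :=
    match i return {linear T i.+1 -> T i} with 0 => z0 | j.+1 => z end.
  exists T, D, idfun; do ![split].
  - by case=> //= i; apply: projective_zero.
  - by move=> x; exists x.
  - by move=> /= ->; exists 0; rewrite linear0.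
  - by move=> [y <-] /=; rewrite z0E.
  - by exists 0; rewrite linear0 [RHS]Z0.
  - by move: i x => [|i] x [y <-] /=; rewrite zE ?z0E.
  - by case=> //= i _; apply: Z0.
move=> [K [P [k [p [[ki sp pE] PP /IH[Q [d [e [PQ [se [eE [dE Q0]]]]]]]]]]]].
pose T i : lmodType R := if i is j.+1 then Q j else P.
pose D i : {linear T i.+1 -> T i} :=
  match i return {linear T i.+1 -> T i} with
  | 0 => (k \o e : {linear Q 0%N -> P})
  | j.+1 => d j
  end.
exists T, D, p; do ![split] => //.
- by case.
- by move=> /pE[y <-]; have [z <-] := se y; exists z.
- by move=> [y <-]; apply/pE; exists (e y).
- case: i x => [|i] x /=.
    move=> kx; apply/eE; apply: ki; rewrite linear0; exact: kx.
  by move=> /dE.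
- case: i x => [|i] x /=; last by move=> /dE.
  by move=> [y <-]; rewrite (_ : e _ = 0) ?linear0 //; apply/eE; exists y.
- by case=> // i ni x; apply: Q0.
Qed.

Lemma proj_dim_le n M : (proj_dim M <= n%:R%:E)%E <-> pdle n M.
Proof.
split=> [Mn|Mn]; last first.
  by apply: ereal_inf_lbound; exists n => //; apply: pdle_resolution.
(* The candidates are integers, so a value of the infimum below [n.+1] exhibits a resolution of
   length at most [n]. *)
have /ereal_inf_lt[_ [m mM <-]] : (proj_dim M < n.+1%:R%:E)%E.
  by apply: (le_lt_trans Mn); rewrite lte_fin ltr_nat.
by rewrite lte_fin ltr_nat ltnS => /pdle_leq; apply; apply: resolution_pdle.
Qed.

Lemma proj_dim_fin M : (proj_dim M < +oo)%E <-> exists n, pdle n M.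
Proof.
split=> [/ereal_inf_lt[_ [m mM _] _]|[n /proj_dim_le Mn]].
  by exists m; apply: resolution_pdle.
by apply: (le_lt_trans Mn); apply: ltry.
Qed.

Lemma proj_dim_ge0 M : (0 <= proj_dim M)%E.
Proof. by apply/ereal_infP => _ [m _ <-]; rewrite lee_fin ler0n. Qed.

(** Reduction to a uniform bound: without one the little dimension is infinite, and with one the
    least bound is attained by minimality. *)
Lemma Fin_dim_le_fin_dim :
  (forall d M, (forall C, Pinf_mod C -> pdle d C) -> Pinf_Mod M -> pdle d M) ->
  fin_dim R = Fin_dim R.
Proof.
move=> H; apply/eqP; rewrite eq_le; apply/andP; split.
  apply: ereal_sup_le => _ [M [[_ Mfin] ->]]; exists M; split=> //.
have fin_ge d : (exists C : lmodType R, Pinf_mod C /\ ~ pdle d C) ->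
    (d.+1%:R%:E <= fin_dim R)%E.
  move=> [C [PC nC]]; apply: le_ereal_sup_tmp; exists (proj_dim C); first by exists C.
  apply/ereal_infP => _ [m /resolution_pdle mC <-].
  rewrite lee_fin ler_nat ltnNge; apply/negP => mn.
  exact/nC/(pdle_leq mn).
have [/nat_least[d [dP dmin]]|nd] :=
    pselect (exists d, forall C : lmodType R, Pinf_mod C -> pdle d C).
  apply: (@le_trans _ _ d%:R%:E).
    by apply/ereal_supP => _ [M [MP ->]]; apply/proj_dim_le; apply: H dP MP.
  (* For [d = 0] there is no smaller bound to violate; the zero module shows that the supremum is at
     least 0. *)
  case: d dP dmin => [|d] dP dmin.
    have [Z Z0] := zero_module_exists.
    apply: le_ereal_sup_tmp; exists (proj_dim Z); last exact: proj_dim_ge0.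
    exists Z; do ![split] => //.
      exists 0%N, (fun=> 0) => x; exists (fun=> 0).
      by rewrite big_ord0 [LHS]Z0.
    by apply/proj_dim_fin; exists 0%N; apply: projective_zero.
  apply: fin_ge; apply: contrapT => nC.
  suff /dmin : forall C, Pinf_mod C -> pdle d C by rewrite ltnn.
  by move=> C PC; apply: contrapT => dC; apply: nC; exists C.
suff -> : fin_dim R = +oo%E by apply: leey.
apply/eqyP => r r0; pose d := Num.trunc r.
apply: (@le_trans _ _ (d.+1%:R%:E)).
  by rewrite lee_fin ltW // -truncn_lt_nat ?ltW.
apply: fin_ge; apply: contrapT => nC; apply: nd; exists d => C PC.
by apply: contrapT => dC; apply: nC; exists C.
Qed.

End ProjectiveDimension.

(** * Splitting of pure embeddings *)

Section PureSplitting.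
Variable R : pzRingType.

(** The subgroups to which the chain condition is applied are values at one element of the solutions
    of finite homogeneous systems; composing a solution with an endomorphism of [T] gives a
    solution, so they are stable. *)
Definition endo_stable (T : lmodType R) (S : set T) : Prop :=
  [/\ S 0, forall x y, S x -> S y -> S (x + y) &
      forall (f : {linear T -> T}) x, S x -> S (f x)].

Definition endo_dcc (T : lmodType R) : Prop :=
  forall F : set (set T), F !=set0 -> (forall S, F S -> endo_stable S) ->
    exists S, F S /\ forall S', F S' -> S' `<=` S -> S `<=` S'.

(** Linearity is read as a system with one equation per triple, of which [L] is a finite part. *)
Definition linear_on (A V : lmodType R) (f : A -> V) (L : seq (R * A * A)) :=
  forall a x y, (a, x, y) \in L -> f (a *: x + y) = a *: f x + f y.

Definition extends_seq (A V : lmodType R) (f : A -> V) (G : seq (A * V)) :=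
  forall x v, (x, v) \in G -> f x = v.

Variables (T N A : lmodType R) (I : choiceType) (c : {linear N -> (I -> T)}).
Variable kappa : {linear N -> A}.
Hypothesis cS : is_dsum c.
Hypothesis Tdcc : endo_dcc T.
Hypothesis finite_split : forall s : seq I, exists r : {linear A -> N},
  forall x, (forall i, c x i <> 0 -> i \in s) -> r (kappa x) = x.

Let graph (p : A * N) : Prop := p.1 = kappa p.2.

(** Finite solvability of the assignments in [Gam] together with the requirement that a solution
    send [kappa n] to [n]. *)
Let good (Gam : set (A * N)) : Prop :=
  forall L (G : seq (A * N)), (forall p, p \in G -> Gam p \/ graph p) ->
    exists f : A -> N, linear_on f L /\ extends_seq f G.

Let good0 : good set0.
Proof.
move=> L G GP; have [supp suppP] := choice (dsum_finsupp cS).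
have [r rP] := finite_split (flatten [seq supp p.2 | p <- G]).
exists r; split=> [a x y _|x v xv]; first by rewrite linearP.
have [//|] := GP _ xv; rewrite /graph /= => ->; apply: rP => i vi.
by apply/flattenP; exists (supp v); [apply: (map_f _ xv)|apply: suppP].
Qed.

(** A finite list of conditions is covered by one member of the chain, or by [set0] if it only uses
    [graph]; the chain may be empty. *)
Let good_bigcup (F : set (set (A * N))) :
  F `<=` good -> total_on F subset -> good (\bigcup_(X in F) X).
Proof.
move=> Fg Ft L G GP.
suff [X [FX XP]] : exists X, (F X \/ X = set0) /\
    forall p, p \in G -> X p \/ graph p.
  case: FX => [/Fg gX|X0]; first exact: gX XP.
  by apply: good0 => p /XP; rewrite X0.
elim: G GP => [|p G IH] GP; first by exists set0; split; [right|].
have [|X [FX XP]] := IH; first by move=> q qG; apply: GP; rewrite inE qG orbT.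
have [[Y FY Yp]|gp] := GP p (mem_head _ _); last first.
  by exists X; split=> // q; rewrite inE => /orP[/eqP ->|/XP]; [right|].
have [XY|YX] : X `<=` Y \/ Y `<=` X.
  case: FX => [FX|->]; last by left.
  exact: Ft.
- exists Y; split; first by left.
  move=> q; rewrite inE => /orP[/eqP ->|/XP[/XY|]]; by [left|left|right].
- exists X; split=> // q; rewrite inE => /orP[/eqP ->|/XP //].
  by left; apply: YX.
Qed.

(** [H L G] collects the values at [a] of homogeneous solutions. Take a finite subsystem for which
    it is minimal and let [n] be the value of a solution [f0]. For a larger subsystem with solution
    [f1], the coordinates of [f0 a - f1 a] lie in the minimal subgroup, hence are values of
    homogeneous solutions of the larger subsystem; adding these to [f1] restores the value [n] at
    [a]. *)
Let good_extend Gam a : good Gam -> exists n, good (Gam `|` [set (a, n)]).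
Proof.
move=> gG.
pose H L (G : seq (A * N)) : set T := [set t | exists h : A -> T,
  [/\ linear_on h L, forall p : A * N, p \in G -> h p.1 = 0 & h a = t]].
pose adm (G : seq (A * N)) := forall p, p \in G -> Gam p \/ graph p.
have [||S [[L0 [G0 [adm0 HS]]] minS]] :=
  Tdcc (F := [set S | exists L G, adm G /\ H L G = S]).
- exists (H [::] [::]); by exists [::], [::].
- move=> _ [L [G [_ <-]]]; split.
  + by exists (fun=> 0); split=> // b x y _; rewrite scaler0 addr0.
  + move=> _ _ [h [hL hG <-]] [h' [hL' hG' <-]]; exists (fun x => h x + h' x).
    split=> // [b x y xy|p pG]; last by rewrite hG ?hG' // addr0.
    by rewrite hL ?hL' // scalerDr addrACA.
  + move=> f _ [h [hL hG <-]]; exists (f \o h).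
    split=> // [b x y xy|p pG] /=; last by rewrite hG // linear0.
    by rewrite hL // linearP.
have [f0 [f0L f0G]] := gG L0 G0 adm0.
exists (f0 a) => L G GP.
pose G' := [seq p <- G | `[< Gam p \/ graph p >]].
have adm1 : adm (G0 ++ G').
  move=> p; rewrite mem_cat => /orP[/adm0 //|].
  by rewrite mem_filter => /andP[/asboolP].
have [f1 [f1L f1G]] := gG (L0 ++ L) _ adm1.
have SH : S `<=` H (L0 ++ L) (G0 ++ G').
  apply: minS; first by exists (L0 ++ L), (G0 ++ G').
  rewrite -HS => _ [h [hL hG <-]]; exists h; split=> //.
    by move=> b x y xy; apply: hL; rewrite mem_cat xy.
  by move=> p pG; apply: hG; rewrite mem_cat pG.
pose d := f0 a - f1 a.
have dS i : S (c d i).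
  rewrite -HS; exists (fun x => c (f0 x - f1 x) i); split=> //.
    move=> b x y xy; rewrite f0L // f1L ?mem_cat ?xy //.
    rewrite opprD addrACA -scalerBr linearP //.
  move=> [x v] xv /=; rewrite (f0G _ _ xv) (f1G x v) ?mem_cat ?xv //.
  by rewrite subrr linear0.
(* The correction is zero wherever [d] has coordinate 0, so that the corrections at each point have
   finite support and define an element of [N]. *)
have hi i : exists h : A -> T,
    [/\ linear_on h (L0 ++ L), forall p, p \in G0 ++ G' -> h p.1 = 0,
        h a = c d i & c d i = 0 -> forall x, h x = 0].
  have [cd0|cd] := pselect (c d i = 0).
    by exists (fun=> 0); split=> // b x y _; rewrite scaler0 addr0.
  by have [h [? ? ?]] := SH _ (dS i); exists h.
have [h hP] := choice hi.
have hN x : exists n, c n = fun i => h i x.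
  apply/cS.2; apply: finsuppW (dsum_finsupp cS d) _ => i di.
  by have [_ _ _ ->] := hP i.
have [g gE] := choice hN.
exists (fun x => f1 x + g x); split=> [b x y xy|x v xv].
  rewrite f1L ?mem_cat ?xy ?orbT //.
  suff -> : g (b *: x + y) = b *: g x + g y by rewrite scalerDr addrACA.
  apply: cS.1; rewrite linearP !gE; apply/funext => i.
  by have [hL _ _ _] := hP i; rewrite hL ?mem_cat ?xy ?orbT.
have [[Gxv|[-> ->]]|gxv] := GP _ xv.
- have xvG' : (x, v) \in G0 ++ G'.
    by rewrite mem_cat mem_filter xv (asboolT (or_introl Gxv)) orbT.
  rewrite (f1G x v) // (_ : g x = 0) ?addr0 //.
  apply: cS.1; rewrite gE linear0; apply/funext => i.
  by have [_ hG _ _] := hP i; rewrite (hG _ xvG').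
- have -> : g a = d.
    by apply: cS.1; rewrite gE; apply/funext => i; have [_ _ ->] := hP i.
  by rewrite addrC subrK.
- have xvG' : (x, v) \in G0 ++ G'.
    by rewrite mem_cat mem_filter xv (asboolT (or_intror gxv)) orbT.
  rewrite (f1G x v) // (_ : g x = 0) ?addr0 //.
  apply: cS.1; rewrite gE linear0; apply/funext => i.
  by have [_ hG _ _] := hP i; rewrite (hG _ xvG').
Qed.

(* A direct sum of copies of [T] is algebraically compact: a maximal finitely
   solvable partial assignment of values to the elements of [A] is total, since
   the possible values at a further element form cosets of subgroups that satisfy
   the descending chain condition. *)
Lemma dsum_pure_splitting : exists r : {linear A -> N}, forall x, r (kappa x) = x.
Proof.
have [Gam [gG maxG]] := Zorn_bigcup good_bigcup.
have tot a : exists n, Gam (a, n).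
  have [n gn] := good_extend a gG; exists n; apply: contrapT => nG.
  apply: (maxG _ _ gn); split=> [p|/(_ (a, n))]; first by left.
  by move=> /(_ (or_intror erefl)).
have [r rP] := choice tot.
have rL : linear r.
  move=> b x y.
  have [|f [fL fG]] := gG [:: (b, x, y)]
    [:: (x, r x); (y, r y); (b *: x + y, r (b *: x + y))].
    by move=> p; rewrite !inE => /or3P[] /eqP ->; left.
  rewrite -(fG (b *: x + y) (r _)) ?inE ?eqxx ?orbT //.
  rewrite -(fG x (r x)) ?inE ?eqxx ?orbT //.
  by rewrite -(fG y (r y)) ?inE ?eqxx ?orbT // fL // inE.
have [r' rE] := linearP_ex rL.
exists r' => n; rewrite rE.
have [|f [_ fG]] := gG [::] [:: (kappa n, r (kappa n)); (kappa n, n)].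
  by move=> p; rewrite !inE => /orP[] /eqP ->; [left|right].
rewrite -(fG (kappa n) (r _)) ?inE ?eqxx //.
by apply: fG; rewrite !inE eqxx orbT.
Qed.

End PureSplitting.

(** * Finite generation and first extension groups *)

Section FinitelyGenerated.
Variable R : pzRingType.
Implicit Types A B C K M P U V : lmodType R.

Lemma finitely_generatedP M : finitely_generated M <->
  exists s : seq M, forall S : set M, is_submod S ->
    (forall x, x \in s -> S x) -> forall x, S x.
Proof.
split=> [[n [g gP]]|[s sP]].
  exists (codom g) => S HS Sg x; have [c ->] := gP x.
  by apply: submod_sum => // i _; apply: submodZ => //; apply: Sg; apply: codom_f.
exists (size s), (tnth (in_tuple s)).
apply: (sP [set x | exists c : 'I_(size s) -> R,
  x = \sum_(i < size s) c i *: tnth (in_tuple s) i]).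
  split=> [|a _ _ [c ->] [c' ->]].
    by exists (fun=> 0); rewrite big1 // => i _; rewrite scale0r.
  exists (fun i => a * c i + c' i); rewrite scaler_sumr -big_split /=.
  by apply: eq_bigr => i _; rewrite scalerDl scalerA.
move=> x xs; have /tnthP[i ->] : x \in in_tuple s by [].
exists (fun j => (j == i)%:R); rewrite (bigD1 i) //= eqxx scale1r big1 ?addr0 //.
by move=> j /negbTE ->; rewrite scale0r.
Qed.

Lemma fg_quotient A B (p : {linear A -> B}) :
  surjective_map p -> finitely_generated A -> finitely_generated B.
Proof.
move=> sp /finitely_generatedP[s sP]; apply/finitely_generatedP.
exists (map p s) => S HS Ss b; have [a <-] := sp b.
by apply: (sP (p @^-1` S)); [exact: submod_preimage|move=> x xs; exact/Ss/map_f].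
Qed.

Lemma fg_ext A B C (i : {linear A -> B}) (p : {linear B -> C}) : ses i p ->
  finitely_generated A -> finitely_generated C -> finitely_generated B.
Proof.
move=> [_ sp pE] /finitely_generatedP[s sP] /finitely_generatedP[t tP].
have [l lK] := choice sp; apply/finitely_generatedP.
exists (map i s ++ map l t) => S HS Ss.
have SA a : S (i a).
  apply: (sP (i @^-1` S)); first exact: submod_preimage.
  by move=> x xs; apply: Ss; rewrite mem_cat map_f.
have SC c : (p @` S) c.
  apply: (tP (p @` S)); first exact: submod_image.
  move=> x xt; exists (l x) => //; apply: Ss.
  by rewrite mem_cat map_f ?orbT.
move=> b; have [b' Sb' pb] := SC (p b).
have /pE[a aE] : p (b - b') = 0 by rewrite linearB pb subrr.
by rewrite -(subrK b' b) -aE; apply: submodD.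
Qed.

Lemma fg_dsum (I : choiceType) M U (c : {linear U -> (I -> M)}) (s : seq I) :
  is_dsum c -> (forall i, i \in s) -> finitely_generated M ->
  finitely_generated U.
Proof.
move=> cS Is /finitely_generatedP[t tP].
have [j jE] := choice (dsum_single cS); apply/finitely_generatedP.
exists [seq j i x | i <- s, x <- t] => S HS Sst.
apply: (dsum_ind cS HS) => i x u cu.
have -> : u = j i x by apply: cS.1; rewrite jE.
move: x {u cu}; apply: (tP (j i @^-1` S)); first exact: submod_preimage.
by move=> x xt; apply/Sst/allpairs_f.
Qed.

Lemma fg_regular : finitely_generated (R^o : lmodType R).
Proof.
exists 1%N, (fun=> 1) => x; exists (fun=> x).
by rewrite big_ord1 /GRing.scale /= mulr1.
Qed.

Lemma fg_projective_cover M : finitely_generated M ->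
  exists P (p : {linear P -> M}),
    [/\ projective P, finitely_generated P & surjective_map p].
Proof.
move=> [n [g gP]]; have [P [c cS]] := dsum_exists 'I_n (R^o : lmodType R).
have [f fE] := choice (fun i => scaler_linear (g i)).
have [p pE] := dsum_lift cS f; have [j jE] := choice (dsum_single cS).
exists P, p; split.
- exact: projective_dsum cS (@projective_regular R).
- by apply: (fg_dsum (s := enum 'I_n) cS) fg_regular => i; rewrite mem_enum.
- move=> x; have [a ->] := gP x.
  exists (\sum_(i < n) j i (a i)); rewrite linear_sum; apply: eq_bigr => i _.
  by rewrite (pE i (a i)) // fE.
Qed.

End FinitelyGenerated.

(** * Vanishing of first extension groups *)

Section Extensions.
Variable R : pzRingType.
Implicit Types A B C E K M N P T V X Y U : lmodType R.

(* Vanishing of [Ext^1(N, V)]. *)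
Definition ext1_zero N V : Prop :=
  forall X Y (i : {linear X -> Y}) (p : {linear Y -> N}), ses i p ->
    forall f : {linear X -> V}, exists g : {linear Y -> V},
      forall x, g (i x) = f x.

Lemma pushout_ses X Y N V (i : {linear X -> Y}) (p : {linear Y -> N})
    (f : {linear X -> V}) : ses i p ->
  exists E (j : {linear V -> E}) (q : {linear E -> N}) (g : {linear Y -> E}),
    ses j q /\ forall x, g (i x) = j (f x).
Proof.
move=> S; have [ii sp pE] := S.
have [h hE] := pair_linear i (\- f : {linear X -> V}).
have hi : injective h by move=> x y; rewrite !hE => /(congr1 fst) /ii.
have [E [k [_ sk kE]]] := inj_ses hi.
have [a aE] := inl_linear Y V; have [b bE] := inr_linear Y V.
have [|q qE] := linear_factor (f := (p \o fst : {linear (Y * V)%type -> N})) sk.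
  by move=> _ /kE[x <-]; rewrite hE /= (ses_comp0 S).
exists E, (k \o b : {linear V -> E}), q, (k \o a : {linear Y -> E}).
split; last first.
  move=> x; apply/eqP; rewrite -subr_eq0 /= -linearB; apply/eqP/kE; exists x.
  rewrite hE /= aE bE; congr pair; first by rewrite subr0.
  by rewrite sub0r.
split.
- apply: linear_inj => v /= /kE[x]; rewrite hE bE => xv.
  have := congr1 fst xv; rewrite /= -(linear0 i) => /ii x0.
  by have := congr1 snd xv; rewrite /= x0 linear0 oppr0.
- by move=> n; have [y <-] := sp n; exists (k (a y)); rewrite qE /= aE.
- move=> e; have [[y v] <-] := sk e; rewrite qE /=; split.
    move=> /pE[x <-]; exists (v + f x); apply/eqP.
    rewrite /= -subr_eq0 -linearB; apply/eqP/kE; exists (- x).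
    rewrite hE bE /=; congr pair; first by rewrite sub0r linearN.
    by rewrite linearN opprK addrC addKr.
  move=> [w /= wE]; have /kE[x] : k (b w - (y, v)) = 0 by rewrite linearB wE subrr.
  rewrite hE bE => /(congr1 fst) /= /eqP; rewrite sub0r -eqr_oppLR => /eqP <-.
  by apply/pE; exists (- x); rewrite linearN.
Qed.

(** Pushing out along [f] turns an extension problem into a splitting problem. *)
Lemma ext1_zero_split N V :
  (forall E (i : {linear V -> E}) (p : {linear E -> N}), ses i p ->
     exists r : {linear E -> V}, forall x, r (i x) = x) ->
  ext1_zero N V.
Proof.
move=> H X Y i p S f; have [E [j [q [g [Sj gE]]]]] := pushout_ses f S.
have [r rK] := H _ _ _ Sj.
by exists (r \o g : {linear Y -> V}) => x; rewrite /= gE rK.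
Qed.

Lemma ext1_zero_retraction N V E (i : {linear V -> E}) (p : {linear E -> N}) :
  ext1_zero N V -> ses i p -> exists r : {linear E -> V}, forall x, r (i x) = x.
Proof. by move=> H S; apply: (H _ _ _ _ S idfun). Qed.

Lemma ext1_zero_projective N V : projective N -> ext1_zero N V.
Proof.
move=> PN; apply: ext1_zero_split => E i p S.
have [s sK] := projective_splitting S PN.
by have [r [rK _]] := splitting_retraction S sK; exists r.
Qed.

(** A lift of [P -> N] to [Y] makes [Y] a quotient of [P * X], so a map on [Y] amounts to a
    compatible pair of maps on [P] and [X]. *)
Lemma ext1_zero_presentation K P N V (k : {linear K -> P}) (p : {linear P -> N}) :
  ses k p -> projective P ->
  (forall f : {linear K -> V}, exists g : {linear P -> V},
    forall x, g (k x) = f x) ->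
  ext1_zero N V.
Proof.
move=> SK PP H X Y i q S f; have [ii sq qE] := S; have [ki sp pE] := SK.
have [l lE] := PP _ _ q p sq.
have [x|f' fE'] := linear_lift (f := (l \o k : {linear K -> Y})) ii.
  by apply/qE; rewrite /= lE (ses_comp0 SK).
have [g gE] := H (f \o f' : {linear K -> V}).
have [s sE] := copair_linear l i.
have [h hE] := copair_linear g f.
have ss : surjective_map s.
  move=> y; have [z zE] := sp (q y).
  have /qE[x xE] : q (y - l z) = 0 by rewrite linearB lE zE subrr.
  by exists (z, x); rewrite sE /= xE addrC subrK.
have [[z x]|g' gE'] := linear_factor (f := h) ss.
  rewrite sE hE /= => zx.
  have /pE[y yE] : p z = 0.
    have := congr1 q zx; rewrite linearD lE (ses_comp0 S) addr0 => ->.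
    by rewrite linear0.
  rewrite -yE gE /= -linearD (_ : f' y + x = 0) ?linear0 //.
  by apply: ii; rewrite linearD fE' /= yE zx linear0.
exists g' => x; have := gE' (0, x).
by rewrite sE hE /= !linear0 !add0r.
Qed.

Lemma ext1_zero_lift C N V E (i : {linear V -> E}) (p : {linear E -> N})
    (f : {linear C -> N}) :
  ext1_zero C V -> ses i p -> exists g : {linear C -> E}, forall x, p (g x) = f x.
Proof.
move=> H S; have [E' [u [v [j [Sj uv vj _ _]]]]] := pullback_ses f S.
have [r rK] := ext1_zero_retraction H Sj.
have [s sK] := retraction_splitting Sj rK.
by exists (v \o s : {linear C -> E}) => x; rewrite /= -uv sK.
Qed.

(** The map is extended in two stages, first to the preimage of [A] in [Y], then to [Y]. *)
Lemma ext1_zero_ext A N C V (i : {linear A -> N}) (p : {linear N -> C}) :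
  ses i p -> ext1_zero A V -> ext1_zero C V -> ext1_zero N V.
Proof.
move=> S HA HC X Y j q Sj f.
have [L [l [u [v [Sl Suv lu _]]]]] := ses_comp S Sj.
have [g gE] := HA _ _ _ _ Suv f; have [h hE] := HC _ _ _ _ Sl g.
by exists h => x; rewrite -lu hE gE.
Qed.

Lemma ext1_zero_dsum (I : choiceType) C U V (c : {linear U -> (I -> C)}) :
  is_dsum c -> ext1_zero C V -> ext1_zero U V.
Proof.
move=> cS H; apply: ext1_zero_split => E i p S.
have [j jE] := choice (dsum_single cS).
have [g gE] := choice (fun k => ext1_zero_lift (j k) H S).
have [s sE] := dsum_lift cS g.
have sK : forall u, p (s u) = u.
  apply: (dsum_ind cS (P := [set u | p (s u) = u])).
    by split=> [|a x y /= xE yE]; rewrite /= ?linear0 // !linearP /= xE yE.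
  move=> k x u cu /=; rewrite (sE _ _ _ cu) gE.
  by apply: cS.1; rewrite jE.
by have [r [rK _]] := splitting_retraction S sK; exists r.
Qed.

Definition noetherian : Prop := forall A B (i : {linear A -> B}),
  injective i -> finitely_generated B -> finitely_generated A.

Lemma finsupp_fg (I : choiceType) M U V (c : {linear U -> (I -> M)})
    (f : {linear V -> U}) :
  is_dsum c -> finitely_generated V ->
  exists s : seq I, forall v i, c (f v) i <> 0 -> i \in s.
Proof.
move=> cS /finitely_generatedP[t tP].
have [supp suppP] := choice (fun v => dsum_finsupp cS (f v)).
exists (flatten (map supp t)); apply: tP.
  split=> [i|a x y Sx Sy i]; first by rewrite !linear0.
  have [x0|/Sx //] := pselect (c (f x) i = 0).
  have [y0|/Sy //] := pselect (c (f y) i = 0).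
  by rewrite !linearP fct_addE fct_scaleE x0 y0 scaler0 addr0.
move=> x xt i /suppP xi; apply/flattenP; exists (supp x) => //.
exact: map_f.
Qed.

(** The syzygy [K] is finitely generated, so a map from it meets finitely many coordinates; these
    are extended one by one, and the remaining ones by zero. *)
Lemma ext1_zero_dsum_target (I : choiceType) T C V (c : {linear V -> (I -> T)}) :
  noetherian -> is_dsum c -> finitely_generated C -> ext1_zero C T ->
  ext1_zero C V.
Proof.
move=> noeth cS fC H; have [P [p [PP fP sp]]] := fg_projective_cover fC.
have [K [k Sk]] := surj_ses sp.
have fK : finitely_generated K by apply: noeth fP; apply: ses_inj Sk.
apply: (ext1_zero_presentation Sk PP) => f.
have [s sP] := finsupp_fg f cS fK.
have Hg i : exists g : {linear P -> T},
    (forall x, g (k x) = c (f x) i) /\ (i \notin s -> forall y, g y = 0).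
  have cL : linear (fun x => c (f x) i) by move=> a x y; rewrite !linearP.
  have [ci ciE] := linearP_ex cL.
  have [ins|nis] := boolP (i \in s).
    by have [g gE] := H _ _ _ _ Sk ci; exists g; split=> // x; rewrite gE ciE.
  have [z zE] := zero_linear P T; exists z; split=> // x; rewrite zE.
  by have [//|/sP] := pselect (c (f x) i = 0); rewrite (negbTE nis).
have [g gP] := choice Hg.
have gL : linear (fun y => (fun i => g i y) : I -> T).
  by move=> a x y; apply/funext => i; rewrite linearP.
have [G GE] := linearP_ex gL.
have [y|h hE] := linear_lift (f := G) cS.1.
  rewrite GE; apply/cS.2; exists s => i gi; apply: contrapT => /negP nis.
  by apply: gi; apply: (gP i).2.
exists h => x; apply: cS.1; rewrite hE GE; apply/funext => i.
exact: (gP i).1.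
Qed.

End Extensions.

(** * Coresolutions by sums of copies of one module *)

Lemma dsum_prod (R : pzRingType) (T U V : lmodType R) (I J : choiceType)
    (c : {linear U -> (I -> T)}) (d : {linear V -> (J -> T)}) :
  is_dsum c -> is_dsum d ->
  exists e : {linear (U * V)%type -> (I + J -> T)}, is_dsum e.
Proof.
move=> cS dS.
pose f (x : U * V) (k : I + J) := match k with inl i => c x.1 i | inr j => d x.2 j end.
have fL : linear f.
  move=> a x y; apply/funext => -[i|j]; rewrite fct_addE fct_scaleE /f /=.
    by rewrite linearP.
  by rewrite linearP.
have [e eE] := linearP_ex fL; exists e; split.
  move=> [x y] [x' y']; rewrite !eE => xy; congr pair.
    by apply: cS.1; apply/funext => i; apply: (congr1 (@^~ (inl i)) xy).
  by apply: dS.1; apply/funext => j; apply: (congr1 (@^~ (inr j)) xy).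
move=> t; split=> [[s sP]|[[x y] <-]].
  have /cS.2[x xE] : finsupp (t \o inl).
    exists (pmap (fun k => if k is inl i then Some i else None) s) => i ti.
    by rewrite mem_pmap; apply/mapP; exists (inl i) => //; apply: sP.
  have /dS.2[y yE] : finsupp (t \o inr).
    exists (pmap (fun k => if k is inr i then Some i else None) s) => i ti.
    by rewrite mem_pmap; apply/mapP; exists (inr i) => //; apply: sP.
  exists (x, y); rewrite eE; apply/funext => -[i|j]; rewrite /f /=.
    by rewrite xE.
  by rewrite yE.
have [s sP] := dsum_finsupp cS x; have [s' sP'] := dsum_finsupp dS y.
exists (map inl s ++ map inr s'); rewrite eE => -[i|j]; rewrite /f mem_cat /=.
  by move=> /sP si; rewrite map_f.
by move=> /sP' sj; rewrite (map_f inr sj) orbT.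
Qed.

Lemma dsum_dsum (R : pzRingType) (T U V : lmodType R) (I J : choiceType)
    (c : {linear U -> (I -> T)}) (d : {linear V -> (J -> U)}) :
  is_dsum c -> is_dsum d ->
  exists e : {linear V -> (J * I -> T)}, is_dsum e.
Proof.
move=> cS dS.
have fL : linear (fun v => (fun k => c (d v k.1) k.2) : J * I -> T).
  by move=> a x y; apply/funext => k; rewrite linearP fct_addE fct_scaleE linearP.
have [e eE] := linearP_ex fL; exists e; split.
  move=> x y; rewrite !eE => xy; apply: dS.1; apply/funext => j; apply: cS.1.
  by apply/funext => i; apply: (congr1 (@^~ (j, i)) xy).
move=> t; split=> [[s sP]|[v <-]].
  have H j : exists u, c u = (fun i => t (j, i)).
    apply/cS.2; exists (map snd s) => i ti; apply/mapP; exists (j, i) => //.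
    exact: sP.
  have [u uE] := choice H.
  have /dS.2[v vE] : finsupp u.
    exists (map fst s) => j uj; apply: contrapT => /negP js; apply: uj.
    apply: cS.1; rewrite uE linear0; apply/funext => i.
    apply: contrapT => /sP /(map_f fst) /=; exact/negP.
  by exists v; rewrite eE vE; apply/funext => -[j i]; rewrite uE.
have [s sP] := dsum_finsupp dS v.
have [s' sP'] := choice (fun j => dsum_finsupp cS (d v j)).
exists [seq (j, i) | j <- s, i <- s' j]; rewrite eE => -[j i] /= vij.
apply/allpairsPdep; exists j, i; split=> //; last exact: sP'.
by apply: sP => vj; apply: vij; rewrite vj linear0.
Qed.

(** Cuts an infinite sum down to a finite one, which stays in [little] when [T] does. *)
Lemma dsum_truncate (R : pzRingType) (T N : lmodType R) (I : choiceType)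
    (c : {linear N -> (I -> T)}) (s : seq I) : is_dsum c ->
  exists (N0 : lmodType R) (c0 : {linear N0 -> (seq_sub s -> T)})
    (inc : {linear N0 -> N}) (pr : {linear N -> N0}),
    [/\ is_dsum c0, forall x, pr (inc x) = x &
        forall x, (forall i, c x i <> 0 -> i \in s) -> inc (pr x) = x].
Proof.
move=> cS; have [N0 [c0 c0S]] := dsum_exists (seq_sub s) T.
have prL : linear (fun x => (fun i => c x (ssval i)) : seq_sub s -> T).
  by move=> a x y; apply/funext => i; rewrite linearP.
have [p pE] := linearP_ex prL.
have [x|pr prE] := linear_lift (f := p) c0S.1.
  rewrite pE; apply/c0S.2; exists (enum {: seq_sub s}) => i _.
  by rewrite mem_enum.
pose g (x : N0) (i : I) : T := if insub i is Some j then c0 x j else 0.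
have gL : linear g.
  move=> a x y; apply/funext => i; rewrite fct_addE fct_scaleE /g.
  by case: insub => [j|]; rewrite ?linearP // scaler0 addr0.
have [g' gE] := linearP_ex gL.
have [x|inc incE] := linear_lift (f := g') cS.1.
  rewrite gE; apply/cS.2; exists s => i; rewrite /g.
  by case: insubP => [j _ <-|//]; case: j.
exists N0, c0, inc, pr; split=> // x.
  apply: c0S.1; rewrite prE pE incE gE; apply/funext => i; rewrite /g.
  by rewrite valK.
move=> xs; apply: cS.1; rewrite incE gE; apply/funext => i; rewrite /g.
case: insubP => [j _ <-|nis]; first by rewrite prE pE.
by have [//|/xs ins] := pselect (c x i = 0); rewrite ins in nis.
Qed.

Section Coresolutions.
Variables (R : pzRingType) (T : lmodType R) (d : nat).
Implicit Types A B C E K M N P U V W X Y Z : lmodType R.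

Definition little M : Prop := finitely_generated M /\ exists n, pdle n M.

Lemma little_ext A B C (i : {linear A -> B}) (p : {linear B -> C}) :
  ses i p -> little A -> little C -> little B.
Proof.
move=> S [fA [n An]] [fC [m Cm]]; split; first exact: fg_ext S fA fC.
exists (maxn n m); apply: pdle_ext S _ _.
  exact: pdle_leq (leq_maxl _ _) An.
exact: pdle_leq (leq_maxr _ _) Cm.
Qed.

Lemma little_coker A B C (i : {linear A -> B}) (p : {linear B -> C}) :
  ses i p -> little A -> little B -> little C.
Proof.
move=> S [fA [n An]] [fB [m Bm]]; split.
  exact: fg_quotient (ses_surj S) fB.
exists (maxn n m).+1; apply: pdle_coker S _ _.
  exact: pdle_leq (leq_maxl _ _) An.
exact: pdleS (pdle_leq (leq_maxr _ _) Bm).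
Qed.

Lemma little_dsum (I : choiceType) M U (c : {linear U -> (I -> M)}) (s : seq I) :
  is_dsum c -> (forall i, i \in s) -> little M -> little U.
Proof.
move=> cS Is [fM [n Mn]]; split; first exact: fg_dsum cS Is fM.
by exists n; apply: pdle_dsum cS Mn.
Qed.

Definition sum_of_copies U : Prop :=
  exists (I : choiceType) (c : {linear U -> (I -> T)}), is_dsum c.

(** From here on [T] enters only through these properties, which the minimal approximation will be
    shown to have. *)
Hypothesis T_dcc : endo_dcc T.
Hypothesis R_noeth : noetherian R.
Hypothesis T_little : little T.
Hypothesis T_ext : forall C, little C -> ext1_zero C T.
Hypothesis T_cogen : forall C, little C ->
  exists (J : choiceType) (t : seq J) (U : lmodType R) (c : {linear U -> (J -> T)})
    (e : {linear C -> U}), [/\ forall j, j \in t, is_dsum c & injective e].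
Hypothesis little_pdle : forall C, little C -> pdle d C.

Lemma sum_of_copies_prod U V :
  sum_of_copies U -> sum_of_copies V -> sum_of_copies (U * V)%type.
Proof.
move=> [I [c cS]] [J [e eS]]; have [f fS] := dsum_prod cS eS.
by exists (I + J)%type, f.
Qed.

Lemma ext1_zero_copies C U : little C -> sum_of_copies U -> ext1_zero C U.
Proof.
move=> LC [I [c cS]]; apply: ext1_zero_dsum_target cS _ _ => //; first exact: LC.1.
exact: T_ext.
Qed.

(** A finite partial sum [U0] is finitely generated, so [f] maps it into a finite partial sum [V0].
    The cokernel of [U0 -> V0] is then in [little], where Ext-injectivity applies. *)
Lemma copies_injective_split U V (f : {linear U -> V}) :
  sum_of_copies U -> sum_of_copies V -> injective f ->
  exists r : {linear V -> U}, forall x, r (f x) = x.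
Proof.
move=> [I [c cS]] [J [e eS]] fi; apply: (dsum_pure_splitting cS) => // s.
have [U0 [c0 [inc [pr [c0S incK prK]]]]] := dsum_truncate s cS.
have U0little : little U0.
  by apply: (little_dsum (s := enum {: seq_sub s}) c0S) => // i; rewrite mem_enum.
have [t tP] := finsupp_fg (f \o inc : {linear U0 -> V}) eS U0little.1.
have [V0 [e0 [inc' [pr' [e0S incK' prK']]]]] := dsum_truncate t eS.
have V0little : little V0.
  by apply: (little_dsum (s := enum {: seq_sub t}) e0S) => // i; rewrite mem_enum.
pose g : {linear U0 -> V0} := pr' \o (f \o inc).
have gE x : inc' (g x) = f (inc x) by apply: prK'; apply: tP.
have gi : injective g.
  by move=> x y /(congr1 inc'); rewrite !gE => /fi /(can_inj incK).
have [C [p S]] := inj_ses gi.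
have C_little : little C by apply: little_coker S _ _.
have CU0 : ext1_zero C U0.
  by apply: ext1_zero_copies => //; exists (seq_sub s), c0.
have [r rK] := ext1_zero_retraction CU0 S.
exists (inc \o (r \o pr') : {linear V -> U}) => x xs /=.
by rewrite -{1}(prK x xs) -gE incK' rK prK.
Qed.

Definition copies_acyclic N : Prop :=
  forall U, sum_of_copies U -> ext1_zero N U.

Lemma copies_acyclic_ext A N C (i : {linear A -> N}) (p : {linear N -> C}) :
  ses i p -> copies_acyclic A -> copies_acyclic C -> copies_acyclic N.
Proof.
by move=> S HA HC U sU; apply: ext1_zero_ext S _ _; [apply: HA|apply: HC].
Qed.

Lemma copies_acyclic_projective P : projective P -> copies_acyclic P.
Proof. by move=> PP U _; apply: ext1_zero_projective. Qed.

Lemma copies_acyclic_little C : little C -> copies_acyclic C.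
Proof. by move=> LC U; apply: ext1_zero_copies. Qed.

Lemma copies_acyclic_dsum (I : choiceType) C U (c : {linear U -> (I -> C)}) :
  is_dsum c -> little C -> copies_acyclic U.
Proof.
move=> cS LC V sV; apply: ext1_zero_dsum cS _.
exact: copies_acyclic_little.
Qed.

Lemma copies_acyclic_copies U : sum_of_copies U -> copies_acyclic U.
Proof. by move=> [I [c cS]]; apply: copies_acyclic_dsum cS T_little. Qed.

(* [M] has a coresolution [0 -> M -> U_1 -> ... -> U_s -> N -> 0] with acyclic
   cosyzygies in which the [U_i] are sums of copies of [T] and [N] has projective
   dimension at most [d]. *)
Fixpoint coresolved s M : Prop :=
  if s is s'.+1 then
    exists U N (e : {linear M -> U}) (q : {linear U -> N}),
      [/\ ses e q, sum_of_copies U, coresolved s' N & copies_acyclic N]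
  else pdle d M.

(** Dual horseshoe: acyclicity of [C] extends [A -> UA] to [B], so [B] embeds in [UA * UC] with
    cokernel an extension of [NC] by [NA]. *)
Lemma coresolved_ext s A B C (i : {linear A -> B}) (p : {linear B -> C}) :
  ses i p -> copies_acyclic C -> coresolved s A -> coresolved s C ->
  coresolved s B.
Proof.
elim: s A B C i p => [|s IH] A B C i p S HC /=; first exact: pdle_ext S.
move=> [UA [NA [eA [qA [SA TA NAs NAac]]]]] [UC [NC [eC [qC [SC TC NCs NCac]]]]].
have [ii sp pE] := S; have [eAi sA AE] := SA; have [eCi sC CE] := SC.
have [f fE] := HC _ TA _ _ _ _ S eA.
have [e eE] := pair_linear f (eC \o p : {linear B -> UC}).
have ei : injective e.
  apply: linear_inj => b; rewrite eE => fb.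
  have /= /eqP := congr1 snd fb; rewrite -(linear0 eC) => /eqP/eCi/pE[a ab].
  have := congr1 fst fb; rewrite /= -ab fE -(linear0 eA) => /eAi ->.
  by rewrite linear0.
have [Q [q Sq]] := inj_ses ei; have [_ sq qE] := Sq.
have [inl inlE] := inl_linear UA UC.
have [x|u uE] := linear_factor (f := (q \o inl : {linear UA -> Q})) sA.
  move=> /AE[a <-]; apply/qE; exists (i a).
  by rewrite eE inlE fE /= (ses_comp0 S) linear0.
have [x|v vE] := linear_factor (f := (qC \o snd : {linear (UA * UC)%type -> NC})) sq.
  by move=> /qE[b <-]; rewrite /= eE /= (ses_comp0 SC).
have Suv : ses u v.
  split.
  - apply: linear_inj => n; have [x <-] := sA n; rewrite uE /= => /qE[b].
    rewrite eE inlE => xb.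
    have /= /eqP := congr1 snd xb; rewrite -(linear0 eC) => /eqP/eCi/pE[a ab].
    have := congr1 fst xb; rewrite /= -ab fE => <-.
    by rewrite (ses_comp0 SA).
  - by move=> n; have [y <-] := sC n; exists (q (0, y)); rewrite vE.
  - move=> w; have [[x y] <-] := sq w; rewrite vE /=; split.
      move=> /CE[c <-]; have [b <-] := sp c; exists (qA (x - f b)).
      rewrite uE /= inlE; apply/eqP; rewrite -subr_eq0 -linearB.
      apply/eqP/qE; exists (- b); rewrite linearN eE /=.
      by congr pair => /=; rewrite ?sub0r // addrAC subrr add0r.
    move=> [n nE]; have [x' xE'] := sA n; move: nE; rewrite -xE' uE /= => nE.
    by rewrite -[y]/(snd (x, y)) -[qC _]/((qC \o snd) (x, y)) -vE -nE vE /= inlE linear0.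
exists (UA * UC)%type, Q, e, q; split=> //.
- exact: sum_of_copies_prod.
- exact: IH Suv NCac NAs NCs.
- exact: copies_acyclic_ext Suv NAac NCac.
Qed.

Lemma coresolved_dsum s (I : choiceType) C U (c : {linear U -> (I -> C)}) :
  is_dsum c -> little C -> coresolved s U.
Proof.
elim: s C U c => [|s IH] C U c cS LC /=.
  by apply: pdle_dsum cS _; apply: little_pdle.
have [J [t [V [e [j [Jt eS ji]]]]]] := T_cogen LC.
have [C' [p S]] := inj_ses ji.
have LV : little V by apply: little_dsum eS Jt _.
have LC' : little C' := little_coker S LC LV.
have [UV [cV SV]] := dsum_exists I V; have [UC [cC SC]] := dsum_exists I C'.
have [f [g [Sfg _ _]]] := dsum_ses cS SV SC S.
have [h hS] := dsum_dsum eS SV.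
exists UV, UC, f, g; split=> //; first by exists (I * J)%type, h.
  exact: IH SC LC'.
exact: copies_acyclic_dsum SC LC'.
Qed.

Lemma coresolved_copies s U : sum_of_copies U -> coresolved s U.
Proof. by move=> [I [c cS]]; apply: coresolved_dsum cS T_little. Qed.

(** Write a free module [F] as the sum of [M] and a projective complement [M'], and embed [F] in [U]
    with cokernel [N]. The cokernel of [M -> U] is an extension of [N] by [M'], and [M'] is
    projective, so the induction hypothesis covers it. *)
Lemma coresolved_projective s M : projective M -> coresolved s M.
Proof.
elim: s M => [|s IH] M PM; first exact: pdle_projective.
have [F [c cS]] := dsum_exists M (R^o : lmodType R).
have [h hE] := choice (@scaler_linear R M).
have [p pE] := dsum_lift cS h; have [j jE] := choice (dsum_single cS).
have sp : surjective_map p.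
  by move=> m; exists (j m 1); rewrite (pE m 1) // hE scale1r.
have [K [k Sk]] := surj_ses sp.
have [l lK] := projective_splitting Sk PM.
have [M' [p' S']] := inj_ses (can_inj lK).
have PF : projective F := projective_dsum cS (@projective_regular R).
have [l' lK'] := retraction_splitting S' lK.
have PM' : projective M' := projective_retract lK' PF.
have LR : little (R^o : lmodType R).
  by split; [exact: fg_regular|exists 0%N; exact: projective_regular].
have [U [N [e [q [S TU Ns Nac]]]]] := coresolved_dsum s.+1 cS LR.
have ei : injective (e \o l : {linear M -> U}).
  by move=> x y /(ses_inj S) /(can_inj lK).
have [Q [t St]] := inj_ses ei; have [_ st tE] := St.
have [x|u uE] := linear_factor (f := (t \o e : {linear F -> Q})) (ses_surj S').
  by have [_ _ pE'] := S'; move=> /pE'[y <-]; apply/tE; exists y.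
have [x|v vE] := linear_factor (f := q) st.
  by move=> /tE[y <-]; apply: (ses_comp0 S).
have Suv : ses u v.
  have [_ sq qE] := S; split.
  - apply: linear_inj => m; have [x <-] := ses_surj S' m.
    rewrite uE /= => /tE[y /(ses_inj S) <-].
    exact: ses_comp0 S' y.
  - by move=> n; have [x <-] := sq n; exists (t x); rewrite vE.
  - move=> w; have [x <-] := st w; rewrite vE; split=> [/qE[y <-]|[m mE]].
      by exists (p' y); rewrite uE.
    have [y yE] := ses_surj S' m; rewrite -vE -mE -yE uE /= vE.
    exact: ses_comp0 S y.
exists U, Q, (e \o l : {linear M -> U}), t; split=> //.
  apply: coresolved_ext Suv Nac _ Ns; exact: IH.
exact: copies_acyclic_ext Suv (copies_acyclic_projective PM') Nac.
Qed.

(* With [M' -> U' -> N' -> U1] and [M -> U] from the coresolutions, the map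
   [U' -> U1 * U] is injective, hence split with retraction [r], and [M''] embeds
   in [U1 * U] via the complement of [U']; the cokernel is an extension of
   [U' * N1] by [N]. *)
Lemma coresolved_coker s M' M M'' (i : {linear M' -> M}) (p : {linear M -> M''}) :
  ses i p -> coresolved s.+2 M' -> coresolved s.+1 M -> coresolved s.+1 M''.
Proof.
move=> S [U' [N' [e' [q' [S' TU' [U1 [N1 [e1 [q1 [S1 TU1 N1s N1ac]]]]] N'ac]]]]].
move=> [U [N [e [q [SM TU Ns Nac]]]]].
have [ii sp pE] := S; have [ei sq qE] := SM.
have [e'i sq' qE'] := S'; have [e1i sq1 qE1] := S1.
have [f fE] := N'ac _ TU _ _ _ _ S' (e \o i : {linear M' -> U}).
have [kap kE] := pair_linear (e1 \o q' : {linear U' -> U1}) f.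
have kap_inj : injective kap.
  apply: linear_inj => t; rewrite kE => k0.
  have /= /eqP := congr1 fst k0; rewrite -(linear0 e1) => /eqP/e1i/qE'[x xt].
  have /= /eqP := congr1 snd k0; rewrite -xt fE /= -(linear0 e) => /eqP/ei.
  by rewrite -(linear0 i) => /ii ->; rewrite linear0.
have TW := sum_of_copies_prod TU1 TU.
have [r rK] := copies_injective_split TU' TW kap_inj.
have [inr inrE] := inr_linear U1 U.
(* Restriction to [U] of the projection [1 - kap r] onto the complement of [U']; it kills the image
   of [M'], where [inr] and [kap] agree. *)
pose eta : {linear U -> (U1 * U)%type} := inr \- (kap \o (r \o inr)).
have etaE t : eta t = inr t - kap (r (inr t)) by [].
have [x|j jE] := linear_factor (f := (eta \o e : {linear M -> _})) sp.
  move=> /pE[y <-] /=.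
  have -> : inr (e (i y)) = kap (e' y).
    by rewrite inrE kE /= fE (ses_comp0 S') linear0.
  by rewrite rK subrr.
(* In effect, the kernel of [eta] is the image of [M'] in [U]. *)
have eta_e t y : eta t = eta (e y) -> exists z, p z = 0 /\ t = e (y + z).
  move=> /eqP; rewrite -subr_eq0 -linearB etaE subr_eq0 => /eqP.
  set u := r _; rewrite inrE kE => E.
  have /= /esym/eqP := congr1 fst E; rewrite -(linear0 e1) => /eqP/e1i/qE'[x xu].
  have /= := congr1 snd E; rewrite -xu fE /= => tE.
  exists (i x); split; first exact: ses_comp0 S x.
  by rewrite linearD -tE addrC subrK.
have ji : injective j.
  apply: linear_inj => m; have [x <-] := sp m; rewrite jE /= => x0.
  have [|z [pz /esym]] := eta_e 0 x; first by rewrite linear0; exact: esym x0.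
  rewrite -(linear0 e) => /ei/(congr1 p).
  by rewrite linearD pz addr0 linear0.
have [Q [t St]] := inj_ses ji; have [_ st tE] := St.
(* [th] is onto [U' * N1] with kernel the image of [eta], so it induces the quotient of [Q] by the
   image of [N]. *)
have [th thE] := pair_linear r (q1 \o fst : {linear (U1 * U)%type -> N1}).
have th_eta u : th (eta u) = 0.
  rewrite thE etaE linearB rK subrr /= inrE kE /= linearB linear0 sub0r.
  by rewrite (ses_comp0 S1) oppr0.
have [x|v vE] := linear_factor (f := th) st.
  by move=> /tE[y <-]; have [z <-] := sp y; rewrite jE /= th_eta.
have [x|u uE] := linear_factor (f := (t \o eta : {linear U -> Q})) sq.
  by move=> /qE[y <-]; apply/tE; exists (p y); rewrite jE.
have Suv : ses u v.
  split.
  - apply: linear_inj => n; have [x <-] := sq n; rewrite uE /= => /tE[m].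
    have [y <-] := sp m; rewrite jE /= => /esym/eta_e[z [_ ->]].
    exact: ses_comp0 SM _.
  - move=> [u' n]; have [a an] := sq1 n.
    exists (t ((a, 0) + kap (u' - r (a, 0)))); rewrite vE thE.
    rewrite linearD rK addrC subrK /=; congr pair.
    by rewrite kE /= linearD an (ses_comp0 S1) addr0.
  - move=> w; have [[a b] <-] := st w; rewrite vE; split; last first.
      move=> [n nE]; have [x xE] := sq n; move: nE; rewrite -xE uE /= => nE.
      by rewrite -vE -nE vE th_eta.
    rewrite thE => th0; have /= r0 := congr1 fst th0.
    have /= /qE1[n na] := congr1 snd th0; have [t' tn] := sq' n.
    exists (q (b - f t')); rewrite uE /= -etaE; congr (t _).
    (* The first coordinate [a] comes from [t'], so subtracting [kap t'] moves [(a, b)] into [U];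
       [eta] then gives back [(a, b)] because [r] vanishes on it. *)
    have E : inr (b - f t') = (a, b) - kap t'.
      by rewrite inrE kE /= tn na; congr pair; rewrite /= subrr.
    by rewrite etaE E linearB rK r0 sub0r linearN opprK subrK.
exists (U1 * U)%type, Q, j, t; split=> //.
  apply: coresolved_ext Suv _ Ns _.
    have [a [b [Sab _ _]]] := prod_ses U' N1.
    exact: copies_acyclic_ext Sab (copies_acyclic_copies TU') N1ac.
  have [a [b [Sab _ _]]] := prod_ses U' N1.
  apply: coresolved_ext Sab N1ac _ N1s; exact: coresolved_copies.
have [a [b [Sab _ _]]] := prod_ses U' N1.
apply: copies_acyclic_ext Suv Nac _.
exact: copies_acyclic_ext Sab (copies_acyclic_copies TU') N1ac.
Qed.

Lemma coresolved_pdle s M : coresolved s M -> pdle d M.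
Proof.
elim: s M => [//|s IH] M [U [N [e [q [S [I [c cS]] /IH Nd _]]]]].
apply: pdle_ker S _ _; last exact: pdleS.
by apply: pdle_dsum cS _; apply: little_pdle.
Qed.

Lemma pdle_finitistic m M : pdle m M -> pdle d M.
Proof.
(* All lengths [s] are treated at once, since the syzygy needs a coresolution one step longer than
   its cokernel. *)
suff H s : pdle m M -> coresolved s.+1 M by move=> /(H 0%N)/coresolved_pdle.
elim: m s M => [|m IH] s M; first exact: coresolved_projective.
move=> [K [P [k [p [S PP Km]]]]].
apply: coresolved_coker S (IH _ _ Km) _; exact: coresolved_projective.
Qed.

End Coresolutions.

(** * Length *)

Section Length.
Variable R : pzRingType.
Implicit Types A B V : lmodType R.

(* [lenle n W]: chains of submodules of [W] have at most [n] proper inclusions. *)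
Fixpoint lenle V n (W : set V) : Prop :=
  if n is m.+1 then forall W', is_submod W' -> W' `<` W -> lenle m W'
  else W `<=` [set 0].

Lemma lenle_sub V n (W W' : set V) : W' `<=` W -> lenle n W -> lenle n W'.
Proof.
case: n => [|n] sW /= HW; first exact: subset_trans sW HW.
move=> S HS [SW nS]; apply: HW => //; split; first exact: subset_trans SW sW.
by move=> WS; apply: nS; apply: subset_trans sW WS.
Qed.

(** By the modular law a proper submodule of [W] is already smaller in the kernel of [g] or in the
    image, so one of the two bounds drops. *)
Lemma lenle_add A B (g : {linear A -> B}) a b (W : set A) : is_submod W ->
  lenle a (W `&` [set x | g x = 0]) -> lenle b (g @` W) -> lenle (a + b) W.
Proof.
move En : (a + b)%N => n; elim: n a b En W => [|n IH] a b En W HW.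
  move/eqP: En; rewrite addn_eq0 => /andP[/eqP -> /eqP ->] /= aW bW x Wx.
  by apply: aW; split=> //; apply: bW; exists x.
move=> aW bW S HS [SW nWS].
have [WS|nWS'] := pselect (W `&` [set x | g x = 0] `<=` S).
  have pS : g @` S `<` g @` W.
    split=> [_ [x Sx <-]|gW]; first by exists x => //; apply: SW.
    apply: nWS => x Wx; have [|y Sy gy] := gW (g x); first by exists x.
    rewrite -(subrK y x); apply: submodD => //; apply: WS; split.
      by apply: submodB => //; apply: SW.
    by rewrite /= linearB gy subrr.
  case: b bW En => [|b] bW En.
    case: (pS) => _ []; apply: subset_trans bW _ => _ ->.
    by exists 0; [exact: HS.1|rewrite linear0].
  apply: (IH a b) => //; first by apply/eqP; rewrite -eqSS -addnS En.
    by apply: lenle_sub aW => x [/SW].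
  by apply: bW => //; apply: submod_image.
have pS : S `&` [set x | g x = 0] `<` W `&` [set x | g x = 0].
  split=> [x [/SW]|WS'] //; apply: nWS' => x /WS'[].
  by [].
case: a aW En => [|a] aW En.
  case: (pS) => _ []; apply: subset_trans aW _ => _ ->.
  by split; [exact: HS.1|rewrite /= linear0].
apply: (IH a b) => //; first by apply/eqP; rewrite -eqSS -addSn En.
  by apply: aW => //; apply: submodI => //; apply: submod_ker.
by apply: lenle_sub bW => _ [x /SW Wx <-]; exists x.
Qed.

Lemma lenle_image A B (f : {linear A -> B}) n (W : set A) :
  is_submod W -> lenle n W -> lenle n (f @` W).
Proof.
elim: n W => [|n IH] W HW /= WP.
  by move=> _ [x /WP -> <-]; rewrite /= linear0.
move=> S HS [SW nWS].
have -> : S = f @` (W `&` f @^-1` S).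
  apply/seteqP; split=> [y Sy|_ [x [_ Sx] <-] //].
  by have [x Wx fx] := SW _ Sy; exists x => //; split=> //=; rewrite fx.
have HS' : is_submod (W `&` f @^-1` S).
  by apply: submodI => //; apply: submod_preimage.
apply: IH => //; apply: WP => //; split=> [x []|WS] //.
by apply: nWS => _ [x /WS[_ Sx] <-].
Qed.

Lemma lenle_inj A B (f : {linear A -> B}) n (W : set A) :
  is_submod W -> injective f -> lenle n (f @` W) -> lenle n W.
Proof.
move=> HW fi fW; rewrite -(add0n n); apply: lenle_add fW => //= x [_ /= fx].
by apply: fi; rewrite fx linear0.
Qed.

Definition finlen V : Prop := exists n, lenle n [set: V].

Lemma finlen_sub A B (i : {linear A -> B}) : injective i -> finlen B -> finlen A.
Proof.
move=> ii [n Bn]; exists n; apply: (lenle_inj _ ii) => //.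
exact: lenle_sub Bn.
Qed.

Lemma lenle_min V (F : set (set V)) : finlen V -> F !=set0 ->
  (forall S, F S -> is_submod S) ->
  exists S, F S /\ forall S', F S' -> S' `<=` S -> S `<=` S'.
Proof.
move=> [N VN] [S0 FS0] FP.
have [|n [[S [FS Sn]] nmin]] := @nat_least (fun n => exists S, F S /\ lenle n S).
  by exists N, S0; split=> //; apply: lenle_sub VN.
exists S; split=> // S' FS' S'S; apply: contrapT => nSS'.
case: n Sn nmin => [|n] Sn nmin.
  apply: nSS'; apply: subset_trans Sn _ => _ ->; exact: (FP _ FS').1.
have /nmin : exists S, F S /\ lenle n S.
  by exists S'; split=> //; apply: Sn => //; apply: FP.
by rewrite ltnn.
Qed.

(** Take the least common bound on the lengths. A member that violates the preceding bound is
    maximal, since a proper submodule of another member would satisfy it. *)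
Lemma lenle_max V (F : set (set V)) : finlen V -> F !=set0 ->
  (forall S, F S -> is_submod S) ->
  exists S, F S /\ forall S', F S' -> S `<=` S' -> S' `<=` S.
Proof.
move=> [N VN] [S0 FS0] FP.
have [|n [nP nmin]] := @nat_least (fun n => forall S, F S -> lenle n S).
  by exists N => S _; apply: lenle_sub VN.
case: n nP nmin => [|n] nP nmin.
  exists S0; split=> // S' FS' _; apply: subset_trans (nP _ FS') _ => _ ->.
  exact: (FP _ FS0).1.
have [S [FS nS]] : exists S, F S /\ ~ lenle n S.
  apply: contrapT => H; have /nmin : forall S, F S -> lenle n S.
    by move=> S FS; apply: contrapT => nS; apply: H; exists S.
  by rewrite ltnn.
exists S; split=> // S' FS' SS'; apply: contrapT => nS'S.
by apply: nS; apply: (nP S') => //; apply: FP.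
Qed.

Definition generated V (s : seq V) : set V :=
  [set x | forall S, is_submod S -> (forall y, y \in s -> S y) -> S x].

Lemma generated_submod V (s : seq V) : is_submod (generated s).
Proof.
split=> [S HS _|a x y Gx Gy S HS Ss]; first exact: HS.1.
by apply: HS.2; [apply: Gx|apply: Gy].
Qed.

Lemma finlen_fg V : finlen V -> finitely_generated V.
Proof.
move=> Vfin; apply/finitely_generatedP.
have [||_ [[s ->] smax]] :=
  @lenle_max V [set S | exists s, S = generated s] Vfin.
- by exists (generated [::]), [::].
- by move=> _ [s ->]; apply: generated_submod.
exists s => S HS Ss x.
have : generated s x; last by apply.
apply: (smax (generated (x :: s))); first by exists (x :: s).
  move=> y sy S' HS' S'P; apply: sy => // z zs; apply: S'P.
  by rewrite inE zs orbT.
by move=> S' _; apply; rewrite mem_head.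
Qed.

Lemma fg_finlen V : finlen (R^o : lmodType R) -> finitely_generated V -> finlen V.
Proof.
move=> [N RN] /finitely_generatedP[s sP].
suff [n [S [HS Ss Sn]]] : exists n (S : set V),
    [/\ is_submod S, forall x, x \in s -> S x & lenle n S].
  by exists n; apply: lenle_sub Sn => x _; apply: sP.
elim: s {sP} => [|x s [n [S [HS Ss Sn]]]].
  exists 0%N, [set 0]; split=> //; exact: submod_set1.
have [Q [q [sq qE]]] := quot_exists HS.
have [f fE] := scaler_linear (q x).
(* The submodule generated by [S] and [x], written as the preimage of a cyclic submodule of the
   quotient by [S]. *)
exists (n + N)%N, (q @^-1` range f); split.
- exact: (submod_preimage q (submod_range f)).
- move=> y; rewrite inE => /orP[/eqP ->|/Ss/qE yS] /=.
    by exists 1 => //; rewrite fE scale1r.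
  by exists 0 => //; rewrite linear0 yS.
- apply: (lenle_add (g := q)).
  + exact: (submod_preimage q (submod_range f)).
  + by apply: lenle_sub Sn => y [_ /= /qE].
  + apply: lenle_sub (lenle_image f (submod_setT _) RN) => _ [y /= fy <-].
    exact: fy.
Qed.

(** [B] is an arbitrary set so that the same argument yields maximal ideals, submodules avoiding an
    element, and complements that make an extension essential. *)
Lemma max_disjoint_submod V (W : set V) (B : set V) :
  is_submod W -> W `&` B `<=` set0 ->
  exists M, [/\ is_submod M, W `<=` M, M `&` B `<=` set0 &
    forall M', is_submod M' -> M `<=` M' -> M' `&` B `<=` set0 -> M' `<=` M].
Proof.
move=> HW WB.
pose P S := S = set0 \/ [/\ is_submod S, W `<=` S & S `&` B `<=` set0].
have [F FP Ft|M [PM maxM]] := @Zorn_bigcup V P.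
  have [F0|[S [FS [x Sx]]]] :
      (forall S, F S -> S = set0) \/ exists S, F S /\ S !=set0.
    have [H|H] := pselect (exists S, F S /\ S !=set0); first by right.
    left=> S FS; apply: contrapT => S0; apply: H; exists S; split=> //.
    exact/set0P/eqP.
  - by left; apply/seteqP; split=> // x [S /F0 ->].
  - have FP' S' y : F S' -> S' y -> [/\ is_submod S', W `<=` S' & S' `&` B `<=` set0].
      by move=> /FP[->|].
    right; split.
    + split=> [|a y z [S1 FS1 S1y] [S2 FS2 S2z]].
        by exists S => //; have [HS _ _] := FP' _ _ FS Sx; exact: HS.1.
      have [H1 _ _] := FP' _ _ FS1 S1y; have [H2 _ _] := FP' _ _ FS2 S2z.
      have [S12|S21] := Ft _ _ FS1 FS2.
        by exists S2 => //; apply: H2.2 => //; apply: S12.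
      by exists S1 => //; apply: H1.2 => //; apply: S21.
    + by move=> y Wy; exists S => //; have [_ WS _] := FP' _ _ FS Sx; apply: WS.
    + move=> y [[S' FS' S'y] By]; have [_ _ S'B] := FP' _ _ FS' S'y.
      exact: (S'B y).
have M0 : M !=set0.
  apply/set0P/eqP => M0; apply: (maxM W); last by right; split.
  by rewrite M0; split=> // /(_ 0 HW.1).
case: PM => [M00|[HM WM MB]]; first by case: M0 => x; rewrite M00.
exists M; split=> // M' HM' MM' M'B; apply: contrapT => nM'M.
by apply: (maxM M') => //; right; split=> //; apply: subset_trans WM MM'.
Qed.

Definition add_span V (W : set V) (u : V) : set V :=
  [set x | exists w c, W w /\ x = w + c *: u].

Lemma add_span_submod V (W : set V) u : is_submod W -> is_submod (add_span W u).
Proof.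
move=> HW; split=> [|a _ _ [w [c [Ww ->]]] [w' [c' [Ww' ->]]]].
  by exists 0, 0; split; [exact: HW.1|rewrite scale0r addr0].
exists (a *: w + w'), (a * c + c'); split; first exact: HW.2.
by rewrite scalerDr scalerDl scalerA addrACA.
Qed.

Lemma max_avoid V (M : set V) (v u : V) :
  (forall M', is_submod M' -> M `<=` M' -> M' `&` [set v] `<=` set0 -> M' `<=` M) ->
  is_submod M -> ~ M u -> exists w c, M w /\ v = w + c *: u.
Proof.
move=> maxM HM nu; apply: contrapT => H; apply: nu.
have MM : M `<=` add_span M u.
  by move=> x Mx; exists x, 0; rewrite scale0r addr0.
apply: (maxM (add_span M u)) => //; first exact: add_span_submod.
  by move=> x [Mx /= xv]; apply: H; rewrite -xv.
by exists 0, 1; rewrite add0r scale1r; split=> //; exact: HM.1.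
Qed.

End Length.

(** * Artinian commutative rings have finite length *)

Section ArtinianRing.
Variable k : comPzRingType.
Local Notation K := (k^o : lmodType k).
Implicit Types I J L m : set K.

Definition maximal_ideal m : Prop :=
  [/\ is_submod m, ~ m 1 & forall c : k, ~ m c -> exists b : k, m (1 - b * c)].

Lemma submod_mull I (a x : k) : is_submod I -> I x -> I (a * x).
Proof. exact: submodZ. Qed.

Lemma submod_addk I (x y : k) : is_submod I -> I x -> I y -> I (x + y).
Proof. exact: (@submodD k K I x y). Qed.

Lemma submod_subk I (x y : k) : is_submod I -> I x -> I y -> I (x - y).
Proof. exact: (@submodB k K I x y). Qed.

Lemma maximal_ideal_exists I : is_submod I -> ~ I 1 ->
  exists m, maximal_ideal m /\ I `<=` m.
Proof.
move=> HI nI1.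
have [|m [Hm Im m1 maxm]] := @max_disjoint_submod k K I [set (1 : k)] HI.
  by move=> x [Ix /= x1]; apply: nI1; rewrite -x1.
exists m; split=> //; split=> // [m1'|c nc]; first exact: (m1 1).
have [w [b [mw wE]]] := max_avoid maxm Hm nc.
by exists b; rewrite [1 : k]wE addrK.
Qed.

Lemma ideal_submod I : is_ideal (k := k) I <-> is_submod I.
Proof.
split=> [[I0 ID IM]|HI]; first by split=> // a x y Ix Iy; apply: ID => //; apply: IM.
split=> [|x y|a x]; [exact: HI.1|exact: submod_addk|exact: submod_mull].
Qed.

Hypothesis k_art : artinian k.

Lemma artinian_min (F : set (set K)) : F !=set0 ->
  (forall S, F S -> is_submod S) ->
  exists S, F S /\ forall S', F S' -> S' `<=` S -> S `<=` S'.
Proof.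
move=> [S0 FS0] FP; apply: contrapT => H.
have next (S : {S | F S}) : exists S' : {S | F S},
    sval S' `<=` sval S /\ ~ sval S `<=` sval S'.
  case: S => S FS /=; apply: contrapT => nS; apply: H; exists S; split=> // S' FS' S'S.
  by apply: contrapT => nSS'; apply: nS; exists (exist _ S' FS').
have [f fP] := choice next.
pose c n := iter n f (exist _ S0 FS0).
have [|n|N NP] := k_art (I := fun n => sval (c n)).
- by move=> n; apply/ideal_submod/FP; case: (c n).
- by have [] := fP (c n).
- have [_] := fP (c N); apply.
  by rewrite -[f (c N)]/(c N.+1) NP.
Qed.

(* Otherwise [m I = I] for all maximal [m]; choose [L] minimal with [L I <> 0].
   Then [L = (x) = x m] for all [m], so the annihilator of [x] lies in no [m]. *)
Lemma artinian_not_mul I : is_submod I -> (exists x, I x /\ x <> 0) ->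
  exists m W, [/\ maximal_ideal m, is_submod W,
    forall a y, m a -> I y -> W (a * y) & ~ I `<=` W].
Proof.
move=> HI [y0 [Iy0 y0N]].
pose F L := is_submod L /\ exists l y : k, [/\ L l, I y & l * y <> 0].
have [||L [[HL [x [y [Lx Iy xy]]]] Lmin]] := artinian_min (F := F).
- exists setT; split; first exact: submod_setT.
  by exists 1, y0; rewrite mul1r.
- by move=> S [].
have Hann : is_submod (V := K) [set c : k | c * x = 0].
  split=> [|a b c /= bx cx]; first by rewrite /= mul0r.
  by rewrite mulrDl -mulrA bx cx mulr0 addr0.
have [|m [mmax annm]] := maximal_ideal_exists Hann.
  by rewrite /= mul1r => x0; apply: xy; rewrite x0 mul0r.
have [Hm m1 minv] := mmax.
pose W : set K := [set z : k | forall S : set K, is_submod S ->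
  (forall a y : k, m a -> I y -> S (a * y)) -> S z].
exists m, W; split=> //.
- split=> [S HS _|a b c Wb Wc S HS SP]; first exact: HS.1.
  by apply: HS.2; [apply: Wb|apply: Wc].
- by move=> a z ma Iz S _; apply.
move=> IW.
have [a [y' [ma Iy' xay]]] : exists a y : k, [/\ m a, I y & x * (a * y) <> 0].
  apply: contrapT => H; apply: xy; apply: (IW y Iy [set z : k | x * z = 0]).
    split=> [|a b c /= xb xc]; first by rewrite /= mulr0.
    by rewrite mulrDr mulrCA xb xc mulr0 addr0.
  by move=> a z ma Iz; apply: contrapT => xaz; apply: H; exists a, z.
pose X : set K := [set z : k | exists b : k, m b /\ z = b * x].
have FX : F X.
  split.
    split=> [|b _ _ [c [mc ->]] [c' [mc' ->]]].
      by exists 0; split; [exact: Hm.1|rewrite mul0r].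
    exists (b * c + c'); split; first exact: Hm.2.
    by rewrite mulrDl -mulrA.
  exists (a * x), y'; split=> //; first by exists a.
  by rewrite -mulrA mulrCA.
have XL : X `<=` L by move=> _ [b [_ ->]]; apply: submod_mull.
have [b [mb xb]] := Lmin _ FX XL _ Lx.
apply: m1; rewrite -(subrK b 1); apply: submod_addk => //.
by apply: annm => /=; rewrite mulrBl mul1r -xb subrr.
Qed.

(** [I/W] is killed by [m], so it is a vector space over [k/m]. A submodule over [W] maximal for
    avoiding [v] meets [I] in a hyperplane: if [v = w + c * t], then [c] is invertible modulo [m],
    and [t] is a multiple of [v] modulo that submodule. *)
Lemma artinian_max_sub I : is_submod I -> (exists x, I x /\ x <> 0) ->
  exists M, [/\ is_submod M, M `<=` I, ~ I `<=` M &
    forall W, is_submod W -> M `<=` W -> W `<=` I -> W `<=` M \/ I `<=` W].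
Proof.
move=> HI I0; have [m [W [[Hm m1 minv] HW mIW nIW]]] := artinian_not_mul HI I0.
have [v [Iv nWv]] : exists v, I v /\ ~ W v.
  by apply: contrapT => H; apply: nIW => x Ix; apply: contrapT => nx; apply: H; exists x.
have [|M [HM WM Mv maxM]] := @max_disjoint_submod k K W [set v] HW.
  by move=> x [Wx /= xv]; apply: nWv; rewrite -xv.
exists (M `&` I); split=> //.
- exact: submodI.
- by move=> IM; apply: (Mv v); split=> //; apply: (IM v Iv).1.
move=> S HS MS SI; have [SM|nSM] := pselect (S `<=` M).
  by left=> x Sx; split; [apply: SM|apply: SI].
right; have [u [Su nMu]] : exists u, S u /\ ~ M u.
  by apply: contrapT => H; apply: nSM => x Sx; apply: contrapT => nx; apply: H; exists x.
(* With [c] in [m], the product [c * t] would lie in [W], and [v] would lie in [M]. *)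
have ncm (t : k) (c : k) w : I t -> M w -> v = w + c * t -> ~ m c.
  move=> It Mw vE mc; apply: (Mv v); split=> //; rewrite vE.
  by apply: submod_addk => //; apply/WM/mIW.
have Sv : S v.
  have [w [c [Mw vE]]] := max_avoid maxM HM nMu.
  rewrite vE; apply: submod_addk => //; last exact: submodZ.
  apply: MS; split=> //; rewrite -(addrK (c *: u) w) -vE.
  by apply: submod_subk => //; apply: submodZ => //; apply: SI.
move=> t It; have [Mt|nMt] := pselect (M t); first by apply: MS.
have [w [c [Mw vE]]] := max_avoid maxM HM nMt.
have [b mb] := minv c (ncm _ _ _ It Mw vE).
have vw : v - w = c * t :> k by rewrite vE addrAC subrr add0r.
have -> : t = (1 - b * c) * t + b * (v - w).
  by rewrite vw mulrBl mul1r mulrA subrK.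
apply: submod_addk => //; first by apply: MS; split; [apply/WM/mIW|apply: submod_mull].
apply: submod_mull => //; apply: submod_subk => //; apply: MS; split=> //.
by rewrite -(addrK (c *: t) w) -vE; apply: submod_subk => //; apply: submodZ.
Qed.

(** A minimal ideal of infinite length has a maximal proper subideal, which is of finite length by
    minimality; the ideal is only one step longer. *)
Lemma artinian_finlen : finlen K.
Proof.
apply: contrapT => nK.
have [||I [[HI nI] minI]] :=
  @artinian_min [set I | is_submod I /\ ~ exists n, lenle n I].
- by exists setT; split; first exact: submod_setT.
- by move=> S [].
have [|M [HM MI nIM MP]] := artinian_max_sub HI.
  apply: contrapT => H; apply: nI; exists 0%N => x Ix; apply: contrapT => x0.
  by apply: H; exists x.
have [n Mn] : exists n, lenle n M.
  by apply: contrapT => nM; apply: (nIM); apply: (minI M).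

have [Q [q [sq qE]]] := quot_exists HM.
apply: nI; exists (n + 1)%N; apply: (lenle_add (g := q)) => //.
  by apply: lenle_sub Mn => x [_ /= /qE].
move=> S HS [SqI nSq] /= y Sy; have [x Ix xy] := SqI _ Sy.
have HS' : is_submod (q @^-1` S `&` I).
  by apply: submodI => //; apply: submod_preimage.
have [||SM|IS] := MP _ HS'.
- by move=> z Mz; split; [rewrite /= (qE z).2 //; exact: HS.1|apply: MI].
- by move=> z [].
- by rewrite -xy; apply/qE/SM; split; rewrite //= xy.
- by case: nSq => _ [z /IS[Sz _] <-].
Qed.

End ArtinianRing.

(** * Restriction of scalars *)

(** A synonym of [M], so that sets and maps pass between both module structures by conversion. *)
Definition restr (k R : pzRingType) (phi : {rmorphism k -> R})
  (M : lmodType R) : Type := M.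

Section Restriction.
Variables (k R : pzRingType) (phi : {rmorphism k -> R}).
Implicit Types A B M : lmodType R.

Section Structure.
Variable M : lmodType R.
Local Notation N := (restr phi M).

HB.instance Definition _ := GRing.Zmodule.on N.

Definition restr_scale (c : k) (x : N) : N := (phi c *: (x : M) : M).

Lemma restr_scaleA a b x : restr_scale a (restr_scale b x) = restr_scale (a * b) x.
Proof. by rewrite /restr_scale scalerA rmorphM. Qed.
Lemma restr_scale1 : left_id 1 restr_scale.
Proof. by move=> x; rewrite /restr_scale rmorph1 scale1r. Qed.
Lemma restr_scaleDr : right_distributive restr_scale +%R.
Proof. by move=> a x y; rewrite /restr_scale scalerDr. Qed.
Lemma restr_scaleDl (x : N) : {morph restr_scale^~ x : a b / a + b >-> a + b}.
Proof. by move=> a b; rewrite /restr_scale rmorphD scalerDl. Qed.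
HB.instance Definition _ := GRing.Zmodule_isLmodule.Build k N
  restr_scaleA restr_scale1 restr_scaleDr restr_scaleDl.

End Structure.

Lemma restr_scaleE M (c : k) (x : restr phi M) : c *: x = (phi c *: (x : M) : M).
Proof. by []. Qed.

Lemma restr_linear A B (f : {linear A -> B}) :
  exists g : {linear restr phi A -> restr phi B}, forall x, g x = f x.
Proof.
by apply: linearP_ex => a x y; rewrite !restr_scaleE linearP.
Qed.

Lemma restr_submod M (S : set M) :
  is_submod S -> is_submod (V := restr phi M) S.
Proof.
by move=> HS; split=> [|a x y Sx Sy]; [exact: HS.1|exact: (HS.2 (phi a))].
Qed.

Definition rfinlen M : Prop := finlen (restr phi M : lmodType k).

Lemma rfinlen_sub A B (i : {linear A -> B}) : injective i -> rfinlen B -> rfinlen A.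
Proof.
have [j jE] := restr_linear i.
by move=> ii; apply: (@finlen_sub _ _ _ j) => x y; rewrite !jE; apply: ii.
Qed.

Lemma rfinlen_fg M : rfinlen M -> finitely_generated M.
Proof.
move=> /finlen_fg/finitely_generatedP[s sP]; apply/finitely_generatedP.
by exists s => S HS Ss; apply: sP => //; exact: (restr_submod HS).
Qed.

Hypothesis k_finlen : finlen (k^o : lmodType k).
Hypothesis R_gen : exists n (g : 'I_n -> R), forall x,
  exists c : 'I_n -> k, x = \sum_(i < n) phi (c i) * g i.

Lemma fg_rfinlen M : finitely_generated M -> rfinlen M.
Proof.
move=> [m [x xP]]; have [n [g gP]] := R_gen.
apply: fg_finlen => //; apply/finitely_generatedP.
exists [seq g i *: x j | i <- enum 'I_n, j <- enum 'I_m] => S HS Ss y.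
have [c ->] := xP y; apply: (submod_sum (V := restr phi M)) => // j _.
have [a ->] := gP (c j); rewrite scaler_suml.
apply: (submod_sum (V := restr phi M)) => // i _.
rewrite -scalerA; apply: (submodZ (V := restr phi M)) => //; apply: Ss.
by apply: (allpairs_f (fun i j => g i *: x j)); rewrite mem_enum.
Qed.

Lemma fin_algebra_noetherian : noetherian R.
Proof. by move=> A B i ii /fg_rfinlen/(rfinlen_sub ii)/rfinlen_fg. Qed.

Hypothesis phi_central : forall c x, phi c * x = x * phi c.

(** Central scalars act by endomorphisms, so endo-stable subgroups are [k]-submodules. *)
Lemma rfinlen_endo_dcc M : rfinlen M -> endo_dcc M.
Proof.
move=> Mfin F F0 FP; apply: (lenle_min Mfin F0) => S /FP[S0 SD SE].
split=> // a x y Sx Sy; apply: SD => //.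
have fL : linear (fun z : M => phi a *: z).
  by move=> b u v; rewrite scalerDr !scalerA phi_central.
by have [f fE] := linearP_ex fL; rewrite restr_scaleE -fE; apply: SE.
Qed.

End Restriction.

(** * A finite length injective cogenerator *)

Section InjectiveCogenerator.
Variable k : comPzRingType.
Implicit Types V X Y E Q : lmodType k.
Hypothesis k_finlen : finlen (k^o : lmodType k).

Definition killed V (m : set (k^o : lmodType k)) (x : V) : Prop :=
  forall c : k, m c -> c *: x = 0.

(* Each simple module occurs at most once in the socle of [V]. *)
Definition thin V : Prop := forall m, maximal_ideal m ->
  forall x y : V, killed m x -> killed m y -> x <> 0 -> exists c : k, y = c *: x.

Lemma killed_submod V m : is_submod [set x : V | killed m x].
Proof.
split=> [c _|a x y xm ym c mc]; first by rewrite scaler0.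
by rewrite scalerDr scalerA mulrC -scalerA xm // ym // scaler0 addr0.
Qed.

(** [x] generates a simple submodule of [k/I]: by minimality of [I + kx], every multiple of [x]
    outside [I] generates [x] again modulo [I]. *)
Lemma minimal_over (I : set (k^o : lmodType k)) : is_submod I -> ~ I 1 ->
  exists x : k, ~ I x /\ maximal_ideal (k := k) [set a : k | I (a * x)].
Proof.
move=> HI nI1.
have [||S [[x [nIx ->]] minS]] := lenle_min
  (F := [set S | exists x : k, ~ I x /\ S = add_span I x]) k_finlen.
- by exists (add_span I (1 : k)), 1.
- by move=> _ [x [_ ->]]; apply: add_span_submod.
exists x; split=> //; split.
- split=> [|a b c /= Ib Ic]; first by rewrite /= mul0r; exact: HI.1.
  by rewrite mulrDl -mulrA; apply: HI.2.
- by rewrite /= mul1r.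
- move=> c /= nIc.
  have [|||w [b [Iw xE]]] := minS (add_span I (c * x)) _ _ x.
  + by exists (c * x).
  + move=> _ [w [b [Iw ->]]]; exists w, (b * c); split=> //.
    by congr (w + _); exact: mulrA.
  + by exists 0, 1; split; [exact: HI.1|rewrite add0r scale1r].
  exists b; rewrite mulrBl mul1r -mulrA {1}xE addrK //.
Qed.

(* If [x] generates a simple submodule [k/m] of [k/I], then multiplication by [x]
   maps the elements killed by [I] to elements killed by [m], which form a module
   of length at most 1, and its kernel consists of the elements killed by [I + kx]. *)
Lemma thin_bound : exists n, forall V, thin V -> lenle n [set: V].
Proof.
pose P (I : set (k^o : lmodType k)) :=
  exists n, forall V, thin V -> lenle n [set x : V | killed I x].
suff [n nP] : P [set 0].
  exists n => V /nP; apply: lenle_sub => x _ c /= ->; exact: scale0r.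
apply: contrapT => nP0.
have [||I [[HI nPI] maxI]] :=
  lenle_max (F := [set I | is_submod I /\ ~ P I]) k_finlen.
- by exists [set 0]; split=> //; exact: submod_set1.
- by move=> S [].
have nI1 : ~ I 1.
  move=> I1; apply: nPI; exists 0%N => V _ x /= /(_ _ I1).
  by rewrite scale1r.
have [x [nIx xmax]] := minimal_over HI nI1.
have [n nP] : P (add_span I x).
  apply: contrapT => nPx; apply: nIx.
  apply: (maxI (add_span I x)).
  - by split=> //; exact: add_span_submod.
  - by move=> y Iy; exists y, 0; rewrite scale0r addr0.
  - by exists 0, 1; split; [exact: HI.1|rewrite add0r scale1r].
apply: nPI; exists (n + 1)%N => V Vthin.
have gL : linear (fun v : V => x *: v).
  by move=> a u v; rewrite scalerDr !scalerA mulrC.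
have [g gE] := linearP_ex gL.
apply: (lenle_add (g := g)); first exact: killed_submod.
  apply: lenle_sub (nP V Vthin) => v [/= Iv]; rewrite gE => xv.
  move=> _ [w [c [Iw ->]]]; rewrite scalerDl Iv // add0r.
  by rewrite -[_ *: v]/((c * x) *: v) -scalerA xv scaler0.
move=> S HS [SW nWS] y Sy; apply: contrapT => /= y0; apply: nWS => _ [v Iv <-].
have gm u : killed I u -> killed [set a : k | I (a * x)] (g u).
  by move=> Iu c /= Icx; rewrite gE scalerA Iu.
have [u Iu uy] := SW _ Sy.
have [c ->] : exists c, g v = c *: y.
  by apply: (Vthin _ xmax) => //; [rewrite -uy; apply: gm|apply: gm].
exact: submodZ.
Qed.

(** [E] has the greatest length that a thin module can have, so it cannot be a proper submodule of
    another one. It plays the part of an injective hull of the sum of one copy of each simple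
    module. *)
Lemma max_thin_exists : exists E, thin E /\
  forall Q (j : {linear E -> Q}), thin Q -> injective j -> surjective_map j.
Proof.
have [n [nP nmin]] := nat_least thin_bound.
case: n nP nmin => [|n] nP nmin.
  have [Z Z0] := zero_module_exists k; exists Z; split.
    by move=> m _ x y _ _ []; apply: Z0.
  move=> Q j /nP Q0 _ q; exists 0; rewrite linear0.
  by have /= -> := Q0 q I.
have [E [Ethin nE]] : exists E, thin E /\ ~ lenle n [set: E].
  apply: contrapT => H; suff /nmin : forall V, thin V -> lenle n [set: V].
    by rewrite ltnn.
  by move=> V Vthin; apply: contrapT => nV; apply: H; exists V.
exists E; split=> // Q j Qthin ji q; apply: contrapT => nq.
apply: nE; apply: (lenle_inj _ ji) => //.
apply: (nP Q Qthin); first exact: submod_range.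
by split=> // /(_ q I)[e _ eq]; apply: nq; exists e.
Qed.

(* For [Z] maximal with [Z] and [E] disjoint in [Y], the quotient [Y/Z] is an essential
   extension of [E], so it has the same socle and is thin. *)
Lemma max_thin_split E : thin E ->
  (forall Q (j : {linear E -> Q}), thin Q -> injective j -> surjective_map j) ->
  forall Y (i : {linear E -> Y}), injective i ->
    exists r : {linear Y -> E}, forall x, r (i x) = x.
Proof.
move=> Ethin Emax Y i ii.
have [|Z [HZ _ Zi maxZ]] := max_disjoint_submod
  (W := [set 0]) (B := [set y | y <> 0 /\ exists e, y = i e]) (submod_set1 Y).
  by move=> _ [/= -> []].
have [Q [q [sq qE]]] := quot_exists HZ.
have [j jE] : exists j : {linear E -> Q}, forall e, j e = q (i e).
  by exists (q \o i : {linear E -> Q}).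
have ji : injective j.
  apply: linear_inj => e; rewrite jE => /qE Zie; apply: ii; rewrite linear0.
  by apply: contrapT => ie0; apply: (Zi (i e)); split=> //; split=> //; exists e.
(* Every simple submodule of [Q] lies in the image of [E]: by maximality of [Z] some nonzero
   [w + c *: y] lies in that of [i], and [c] is invertible modulo [m]. *)
have soc m x : maximal_ideal m -> killed m x -> exists e, j e = x.
  move=> [Hm m1 minv] xm; have [y yx] := sq x.
  have [Zy|nZy] := pselect (Z y).
    by exists 0; rewrite linear0 -yx; apply/esym/qE.
  have [_ [[w [c [Zw ->]]] [wcy0 [e wcyE]]]] :
      exists z, add_span Z y z /\ z <> 0 /\ exists e, z = i e.
    apply: contrapT => H; apply: nZy; apply: (maxZ (add_span Z y)).
    - exact: add_span_submod.
    - by move=> z Zz; exists z, 0; rewrite scale0r addr0.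
    - by move=> z [zs zi]; apply: H; exists z.
    - by exists 0, 1; split; [exact: HZ.1|rewrite add0r scale1r].
  have jeE : j e = c *: x.
    by rewrite jE -wcyE linearD (qE w).2 // add0r linearZ yx.
  have nc : ~ m c.
    move=> mc; apply: wcy0; rewrite wcyE (_ : e = 0) ?linear0 //.
    by apply: ji; rewrite jeE xm // linear0.
  have [b mb] := minv c nc; exists (b *: e).
  rewrite linearZ /= jeE scalerA.
  by have := xm _ mb; rewrite scalerBl scale1r => /eqP; rewrite subr_eq0 => /eqP.
have Qthin : thin Q.
  move=> m mmax x y xm ym x0.
  have [e ex] := soc m x mmax xm; have [e' ey] := soc m y mmax ym.
  have [|||c cE] := Ethin m mmax e e'.
  - by move=> c mc; apply: ji; rewrite linearZ /= ex xm // linear0.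
  - by move=> c mc; apply: ji; rewrite linearZ /= ey ym // linear0.
  - by move=> e0; apply: x0; rewrite -ex e0 linear0.
  by exists c; rewrite -ex -ey cE linearZ.
have [y|r rE] := linear_lift (f := q) ji; first exact: Emax.
by exists r => e; apply: ji; rewrite rE jE.
Qed.

(** If [k/m] did not occur in [E], then [E * k/m] would be a thin module properly containing [E]. *)
Lemma max_thin_simple E : thin E ->
  (forall Q (j : {linear E -> Q}), thin Q -> injective j -> surjective_map j) ->
  forall m, maximal_ideal m -> exists e : E, e <> 0 /\ killed m e.
Proof.
move=> Ethin Emax m mmax; have [Hm m1 minv] := mmax.
apply: contrapT => nE.
have E0 (e : E) : killed m e -> e = 0.
  by move=> em; apply: contrapT => e0; apply: nE; exists e.
have [S [q [sq qE]]] := quot_exists Hm.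
have [j jE] := inl_linear E S.
suff ESthin : thin (E * S)%type.
  have [|e] := Emax _ j ESthin _ (0, q (1 : k)).
    by move=> x y; rewrite !jE => /(congr1 fst).
  by rewrite jE => /(congr1 snd) /= /esym/qE.
move=> m' m'max [x s] [y t] xm ym xs0; have [Hm' m'1 m'inv] := m'max.
have xm' : killed m' x by move=> c /xm /(congr1 fst).
have sm' : killed m' s by move=> c /xm /(congr1 snd).
have ym' : killed m' y by move=> c /ym /(congr1 fst).
have tm' : killed m' t by move=> c /ym /(congr1 snd).
(* If both second components vanish, thinness of [E] decides. Otherwise [m' = m], the first
   components vanish by [E0], and any nonzero element generates [S = k/m]. *)
have [[s0 t0]|st] := pselect (s = 0 /\ t = 0).
  have [|c ->] := Ethin m' m'max x y xm' ym'.
    by move=> x0; apply: xs0; rewrite x0 s0.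
  by exists c; rewrite s0 t0; congr pair; rewrite /= scaler0.
have sub (u : S) : killed m' u -> u <> 0 -> m' `<=` m.
  have [a <-] := sq u => um' u0 c m'c.
  have /qE mca : q (c * a) = 0 by have := um' c m'c; rewrite -linearZ.
  have nma : ~ m a by move=> /qE.
  have [b mb] := minv a nma.
  have -> : c = c * (1 - b * a) + b * (c * a).
    by rewrite mulrBr mulr1 mulrCA subrK.
  by apply: submod_addk => //; apply: submod_mull.
have m'm : m' `<=` m.
  have [s0|s0] := pselect (s = 0); last exact: sub sm' s0.
  by apply: sub tm' _ => t0; apply: st.
have mm' : m `<=` m'.
  move=> c mc; apply: contrapT => m'c; have [b /m'm mb] := m'inv c m'c.
  apply: m1; rewrite -(subrK (b * c) 1); apply: submod_addk => //.
  exact: submod_mull.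
have x0 : x = 0 by apply: E0 => c /mm'; apply: xm'.
have y0 : y = 0 by apply: E0 => c /mm'; apply: ym'.
have s0 : s <> 0 by move=> s0; apply: xs0; rewrite x0 s0.
have [a as_] := sq s; have [a' at_] := sq t.
have nma : ~ m a by move=> /qE qa; apply: s0; rewrite -as_.
have [b mb] := minv a nma.
exists (a' * b); rewrite x0 y0; congr pair; rewrite /= ?scaler0 //.
rewrite -as_ -at_ -linearZ; apply/eqP; rewrite -subr_eq0 -linearB; apply/eqP/qE.
have -> : a' - (a' * b) *: (a : k^o) = a' * (1 - b * a) :> k.
  by rewrite mulrBr mulr1 mulrA.
exact: submod_mull.
Qed.

Definition injective_module (R : pzRingType) (E : lmodType R) : Prop :=
  forall (X Y : lmodType R) (i : {linear X -> Y}) (f : {linear X -> E}),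
    injective i -> exists g : {linear Y -> E}, forall x, g (i x) = f x.

Definition cogenerator (R : pzRingType) (E : lmodType R) : Prop :=
  forall (V : lmodType R) (v : V), v <> 0 ->
    exists f : {linear V -> E}, f v <> 0.

Lemma finlen_injective_cogenerator :
  exists E, [/\ finlen E, injective_module E & cogenerator E].
Proof.
have [E [Ethin Emax]] := max_thin_exists.
have Einj : injective_module E.
  move=> X Y i f ii; have [C [p S]] := inj_ses ii.
  have [E' [j [q [g [Sj gE]]]]] := pushout_ses f S.
  have [r rK] := max_thin_split Ethin Emax (ses_inj Sj).
  by exists (r \o g : {linear Y -> E}) => x; rewrite /= gE rK.
exists E; split=> //; first by have [n nP] := thin_bound; exists n; apply: nP.
(* The annihilator of [v] lies in a maximal ideal [m], so sending [v] to a nonzero element killed by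
   [m] is well defined on [kv]; injectivity extends the map to [V]. *)
move=> V v v0; have [s sE] := scaler_linear v.
have [|m [mmax annm]] := maximal_ideal_exists (submod_ker s).
  by rewrite /= sE scale1r.
have [e [e0 em]] := max_thin_simple Ethin Emax mmax.
have [X [i [ii iE]]] := sub_exists (submod_range s).
have [c|t tE] := linear_lift (f := s) ii; first by apply/iE; exists c.
have st : surjective_map t.
  move=> x; have [c _ cx] : range s (i x) by apply/iE; exists x.
  by exists c; apply: ii; rewrite tE.
have [h hE] := scaler_linear e.
have [c|f fE] := linear_factor (f := h) st.
  by move=> tc; rewrite hE; apply/em/annm; rewrite /= -tE tc linear0.
have [g gE] := Einj _ _ _ f ii; exists g.
rewrite (_ : v = i (t 1)); first by rewrite gE fE hE scale1r.
by rewrite tE sE scale1r.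
Qed.

End InjectiveCogenerator.

(** * The minimal approximation of an injective cogenerator *)

Section Coinduction.
Variables (k : comPzRingType) (R : pzRingType) (phi : {rmorphism k -> R}).
Hypothesis phi_central : forall c x, phi c * x = x * phi c.
Variable E : lmodType k.

Definition coind_set : set (R -> E) :=
  [set f | forall c x y, f (phi c * x + y) = c *: f x + f y].

Lemma coind_submod : is_submod coind_set.
Proof.
split=> [c x y|a f g fP gP c x y]; first by rewrite scaler0 addr0.
rewrite !fct_addE !fct_scaleE fP gP !scalerDr !scalerA mulrC.
by rewrite -!addrA; congr (_ + _); rewrite addrCA.
Qed.

(* [Hom_k(R, E)], with [R] acting by [(r f) x = f (x r)]. *)
Definition coind of (forall c x, phi c * x = x * phi c) : Type :=
  subm_type coind_submod.
Local Notation I := (coind phi_central).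

HB.instance Definition _ := GRing.Zmodule.on I.

Definition coind_fun (f : I) : R -> E := sval f.

Lemma coind_funP (f : I) c x y :
  coind_fun f (phi c * x + y) = c *: coind_fun f x + coind_fun f y.
Proof. by case: f => f fP /=; move/asboolP: fP; apply. Qed.

Lemma coind_fun_inj (f g : I) : (forall x, coind_fun f x = coind_fun g x) -> f = g.
Proof. by move=> fg; apply: val_inj; apply/funext. Qed.

Lemma coind_exists (h : R -> E) : coind_set h -> exists f : I, coind_fun f = h.
Proof. by move=> hP; exists (exist _ h (asboolT hP)). Qed.

Lemma coind_funD (f g : I) x : coind_fun (f + g) x = coind_fun f x + coind_fun g x.
Proof. by []. Qed.

Lemma coind_fun0 (f : I) : coind_fun f 0 = 0.
Proof.
have := coind_funP f 1 0 0; rewrite mulr0 addr0 scale1r => /eqP.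
by rewrite -subr_eq0 opprD addrA subrr sub0r oppr_eq0 => /eqP.
Qed.

Lemma coind_fun_phi (f : I) c x : coind_fun f (phi c * x) = c *: coind_fun f x.
Proof. by rewrite -[_ * x]addr0 coind_funP coind_fun0 addr0. Qed.

Lemma coind_scale_subproof (r : R) (f : I) :
  coind_set (fun x => coind_fun f (x * r)).
Proof. by move=> c x y; rewrite mulrDl -mulrA coind_funP. Qed.

Definition coind_scale (r : R) (f : I) : I :=
  exist _ (fun x => coind_fun f (x * r)) (asboolT (coind_scale_subproof r f)).

Lemma coind_scaleA a b f : coind_scale a (coind_scale b f) = coind_scale (a * b) f.
Proof. by apply: coind_fun_inj => x; rewrite /coind_fun /= /coind_fun -mulrA. Qed.
Lemma coind_scale1 : left_id 1 coind_scale.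
Proof. by move=> f; apply: coind_fun_inj => x; rewrite /coind_fun /= mulr1. Qed.
Lemma coind_scaleDr : right_distributive coind_scale +%R.
Proof. by move=> a f g; apply: coind_fun_inj. Qed.
Lemma coind_scaleDl f : {morph coind_scale^~ f : a b / a + b >-> a + b}.
Proof.
move=> a b; apply: coind_fun_inj => x; rewrite coind_funD /= mulrDr.
by have := coind_funP f 1 (x * a) (x * b); rewrite rmorph1 mul1r scale1r.
Qed.
HB.instance Definition _ := GRing.Zmodule_isLmodule.Build R I
  coind_scaleA coind_scale1 coind_scaleDr coind_scaleDl.

Lemma coind_funZ r (f : I) x : coind_fun (r *: f) x = coind_fun f (x * r).
Proof. by []. Qed.

(** Adjunction between restriction and coinduction; [g] is recovered by evaluation at 1. *)
Lemma coind_lift (B : lmodType R) (g : {linear restr phi B -> E}) :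
  exists h : {linear B -> I}, forall b x, coind_fun (h b) x = g (x *: b).
Proof.
have gP (b : B) : coind_set (fun x => g (x *: b)).
  by move=> c x y; rewrite scalerDl -scalerA -linearP.
have [h hE] := choice (fun b => coind_exists (gP b)).
have hL : linear h.
  move=> a u v; apply: coind_fun_inj => x.
  rewrite coind_funD coind_funZ !hE scalerDr !scalerA.
  exact: (linearD g).
have [h' hE'] := linearP_ex hL.
by exists h' => b x; rewrite hE' hE.
Qed.

Lemma coind_injective : injective_module E -> injective_module (I : lmodType R).
Proof.
move=> Einj X Y i f ii; have [i' iE] := restr_linear phi i.
have fL : linear (fun x : restr phi X => coind_fun (f x) 1).
  move=> a u v; rewrite restr_scaleE linearP coind_funD coind_funZ.
  by rewrite mul1r -[phi a]mulr1 coind_fun_phi.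
have [f' fE'] := linearP_ex fL.
have i'i : injective i' by move=> x y; rewrite !iE; apply: ii.
have [g gE] := Einj _ _ i' f' i'i.
have [h hE] := coind_lift g; exists h => x; apply: coind_fun_inj => r.
rewrite hE -linearZ -iE gE fE' /=.
by rewrite linearZ coind_funZ mul1r.
Qed.

Lemma coind_cogenerator : cogenerator E -> cogenerator (I : lmodType R).
Proof.
move=> Ecog V v v0; have [g gv] := Ecog (restr phi V) v v0.
have [h hE] := coind_lift g; exists h => hv; apply: gv.
by have := hE v 1; rewrite hv scale1r => <-.
Qed.

(** Evaluation at the generators [g i] embeds the module in a finite sum of copies of [E]. *)
Lemma coind_rfinlen : finlen (k^o : lmodType k) -> finlen E ->
  (exists n (g : 'I_n -> R), forall x,
    exists c : 'I_n -> k, x = \sum_(i < n) phi (c i) * g i) ->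
  rfinlen phi (I : lmodType R).
Proof.
move=> k_fin E_fin [n [g gP]].
have evL : linear (fun f : restr phi I => (fun i => coind_fun f (g i)) : 'I_n -> E).
  move=> a u v; apply/funext => i; rewrite fct_addE fct_scaleE restr_scaleE.
  by rewrite coind_funD coind_funZ -phi_central coind_fun_phi.
have [ev evE] := linearP_ex evL.
have [U [c cS]] := dsum_exists 'I_n E.
have [f|j jE] := linear_lift (f := ev) cS.1.
  by rewrite evE; apply/cS.2; exists (enum 'I_n) => i; rewrite mem_enum.
apply: (@finlen_sub _ _ _ j).
  apply: linear_inj => f jf; apply: coind_fun_inj => x.
  have fg i : coind_fun f (g i) = 0.
    have := congr1 (@^~ i) (jE f).
    by rewrite jf evE linear0 => <-.
  have [a ->] := gP x; elim/big_rec: _ => [|i y _ IH]; rewrite ?coind_fun0 //.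
  by rewrite coind_funP fg scaler0 add0r.
apply: fg_finlen => //; apply: (fg_dsum (s := enum 'I_n) cS).
  by move=> i; rewrite mem_enum.
exact: finlen_fg.
Qed.

End Coinduction.

(** * Minimal right approximations: existence, Ext-injectivity, cogeneration *)

Section MinimalApproximation.
Variables (k R : pzRingType) (phi : {rmorphism k -> R}).
Hypothesis fg_finite : forall M : lmodType R, finitely_generated M -> rfinlen phi M.
Implicit Types A B C E J T M : lmodType R.

(** Take a surjective [g] with maximal kernel; composing with [f] cannot enlarge it, which forces
    [f] to be injective. *)
Lemma rfinlen_surj_inj M (f : {linear M -> M}) :
  rfinlen phi M -> surjective_map f -> injective f.
Proof.
move=> Mfin sf; apply: linear_inj => x fx.
have [||S [[g [sg ->]] gmax]] := lenle_max (V := restr phi M : lmodType k)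
  (F := [set S | exists g : {linear M -> M},
    surjective_map g /\ S = [set x | g x = 0]]) Mfin.
- by exists [set x | x = 0], idfun; split=> // y; exists y.
- by move=> _ [g [_ ->]]; exact: (restr_submod phi (submod_ker g)).
have [y yx] := sg x; rewrite -yx.
apply: (gmax [set z | (f \o g : {linear M -> M}) z = 0]).
- exists (f \o g : {linear M -> M}); split=> // z.
  by have [w <-] := sf z; have [v <-] := sg w; exists v.
- by move=> z /= ->; rewrite linear0.
- by rewrite /= yx.
Qed.

Variable I : lmodType R.

Definition approximation A (f : {linear A -> I}) : Prop :=
  little A /\ forall B (g : {linear B -> I}), little B ->
    exists h : {linear B -> A}, forall x, g x = f (h x).

(* An endomorphism over [I] with minimal image maps its image [B] onto itself, so
   [B] is a retract of [A] and still an approximation; if [A] has minimal length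
   then [B = A]. *)
Lemma minimal_approximation :
  (exists A (f : {linear A -> I}), approximation f) ->
  exists A (f : {linear A -> I}), approximation f /\
    forall h : {linear A -> A}, (forall x, f (h x) = f x) ->
      injective h /\ surjective_map h.
Proof.
move=> [A0 [f0 f0P]].
have [|n [[A [f [fP An]]] nmin]] := @nat_least (fun n =>
    exists A (f : {linear A -> I}), approximation f /\ lenle n [set: restr phi A]).
  by have [n A0n] := fg_finite f0P.1.1; exists n, A0, f0.
have Afin : rfinlen phi A by exists n.
have [||_ [[g [gf ->]] gmin]] := lenle_min (V := restr phi A : lmodType k)
  (F := [set S | exists g : {linear A -> A},
    (forall x, f (g x) = f x) /\ S = range g]) Afin.
- by exists (range (idfun : {linear A -> A})), idfun.
- by move=> _ [g [_ ->]]; exact: (restr_submod phi (submod_range g)).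
have [B [i [ii iE]]] := sub_exists (submod_range g).
have [a|r0 r0E] := linear_lift (f := g) ii; first by apply/iE; exists a.
have sr0 : surjective_map r0.
  move=> b; have /iE[a _ ab] : exists y, i y = i b by exists b.
  by exists a; apply: ii; rewrite r0E.
have su : surjective_map (r0 \o i : {linear B -> B}).
  move=> b; have /iE ib : exists y, i y = i b by exists b.
  have [||a' _ ab] := gmin (range (g \o g : {linear A -> A})) _ _ _ ib.
  - by exists (g \o g : {linear A -> A}); split=> // x; rewrite /= !gf.
  - by move=> _ [x _ <-]; exists (g x).
  - by exists (r0 a'); apply: ii; rewrite /= !r0E -ab.
have Bfin : rfinlen phi B := rfinlen_sub ii Afin.
have ui := rfinlen_surj_inj Bfin su.
have [x|v vE] := linear_factor (f := idfun) su.
  by move=> x0; apply: ui; rewrite x0 linear0.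
have rK x : (v \o r0 : {linear A -> B}) (i x) = x by exact: vE.
have fiP : approximation (f \o i : {linear B -> I}).
  split; first split.
  - exact: fg_quotient sr0 fP.1.1.
  - have [m Am] := fP.1.2; exists m; exact: pdle_retract rK Am.
  - move=> C h Cl; have [h' hE] := fP.2 _ h Cl.
    by exists (r0 \o h' : {linear C -> B}) => x; rewrite hE /= r0E gf.
(* If [g] were not onto, [B] would be an approximation of smaller length than the least one. *)
have gT : [set: A] `<=` range g.
  case: n An nmin => [|n] An nmin.
    by move=> x /An ->; exists 0; rewrite ?linear0.
  apply: contrapT => ng; have [j jE] := restr_linear phi i.
  have : (n.+1 <= n)%N; last by rewrite ltnn.
  apply: nmin; exists B, (f \o i : {linear B -> I}); split=> //.
  apply: (@lenle_inj _ _ _ j) => //; first by move=> x y; rewrite !jE; apply: ii.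
  apply: (@lenle_sub k (restr phi A) n (range g)).
    by move=> _ [x _ <-]; rewrite jE; apply/iE; exists x.
  by apply: An; first exact: (restr_submod phi (submod_range g)).
(* The minimal image is all of [A], so every endomorphism over [I] is onto, and finite length makes
   it injective. *)
exists A, f; split=> // h hf; have sh : surjective_map h.
  move=> x; have [||y _ <-] := gmin (range h) _ _ x (gT x Logic.I).
  - by exists h.
  - by move=> y _; apply: gT.
  - by exists y.
by split=> //; exact: rfinlen_surj_inj.
Qed.

Variables (T : lmodType R) (f : {linear T -> I}).
Hypothesis f_approx : approximation f.
Hypothesis f_min : forall h : {linear T -> T}, (forall x, f (h x) = f x) ->
  injective h /\ surjective_map h.
Hypothesis I_inj : injective_module I.
Hypothesis I_cogen : cogenerator I.

Lemma approximation_ext C : little C -> ext1_zero C T.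
Proof.
move=> LC; apply: ext1_zero_split => E i p S.
have [g gE] := I_inj f (ses_inj S).
have [h hE] := f_approx.2 _ g (little_ext S f_approx.1 LC).
have [|wi sw] := f_min (h := (h \o i : {linear T -> T})).
  by move=> x; rewrite /= -hE gE.
have [x|v vE] := linear_factor (f := idfun) sw.
  by move=> x0; apply: wi; rewrite x0 linear0.
by exists (v \o h : {linear E -> T}); exact: vE.
Qed.

(** Choose a map to a finite sum of copies of [T] with minimal kernel. A nonzero [x] in the kernel
    is detected by a map to [I]; its factor through [T], added as a further coordinate, would shrink
    the kernel. *)
Lemma approximation_cogen C : little C ->
  exists (J : choiceType) (t : seq J) (U : lmodType R) (c : {linear U -> (J -> T)})
    (e : {linear C -> U}), [/\ forall j, j \in t, is_dsum c & injective e].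
Proof.
move=> LC; have Cfin := fg_finite LC.1.
have [||_ [[J [t [U [c [e [Jt cS ->]]]]]] emin]] :=
  lenle_min (V := restr phi C : lmodType k)
    (F := [set S | exists (J : choiceType) (t : seq J) (U : lmodType R)
    (c : {linear U -> (J -> T)}) (e : {linear C -> U}),
    [/\ forall j, j \in t, is_dsum c & S = [set x | e x = 0]]]) Cfin.
- have [U [c cS]] := dsum_exists void T; have [z zE] := zero_linear C U.
  exists [set x | z x = 0], void, [::], U, c, z; split=> //; by case.
- move=> _ [J [t [U [c [e [_ _ ->]]]]]].
  exact: (restr_submod phi (submod_ker e)).
exists J, t, U, c, e; split=> //; apply: linear_inj => x ex.
apply: contrapT => x0; have [g gx] := I_cogen x0.
have [h hE] := f_approx.2 _ g LC.
have [U1 [c1 c1S]] := dsum_exists unit T; have [j jE] := dsum_single c1S tt.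
have [c2 c2S] := dsum_prod cS c1S.
have [e2 e2E] := pair_linear e (j \o h : {linear C -> U1}).
have : e2 x = 0.
  apply: (emin [set x | e2 x = 0]) => //.
    exists (J + unit)%type, (map inl t ++ [:: inr tt]), (U * U1)%type, c2, e2.
    split=> // -[i|[]]; rewrite mem_cat ?map_f ?Jt //.
    by rewrite inE orbT.
  by move=> y /=; rewrite e2E => /(congr1 fst).
rewrite e2E => /(congr1 snd) /= jhx; apply: gx; rewrite hE.
have := congr1 (@^~ tt) (jE (h x)); rewrite jhx linear0 /single eqxx => <-.
by rewrite linear0.
Qed.

End MinimalApproximation.

Lemma littleP (R : pzRingType) (M : lmodType R) : Pinf_mod M <-> little M.
Proof.
split=> -[fM MP]; split=> //; first by apply/proj_dim_fin.
by apply/proj_dim_fin.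
Qed.

Theorem theorem4p1 (Lambda : pzRingType) :
  artin_algebra Lambda ->
  contravariantly_finite (@Pinf_mod Lambda) ->
  fin_dim Lambda = Fin_dim Lambda.
Proof.
move=> [k [phi [k_art phi_central L_gen]]] cf.
have k_fin := artinian_finlen k_art.
have fg_fin := fg_rfinlen k_fin L_gen.
have [E [E_fin E_inj E_cog]] := finlen_injective_cogenerator k_fin.
have I_fin := coind_rfinlen phi_central k_fin E_fin L_gen.
have I_inj := @coind_injective _ _ _ phi_central _ E_inj.
have I_cog := @coind_cogenerator _ _ _ phi_central _ E_cog.
set I := (coind E phi_central : lmodType Lambda) in I_fin I_inj I_cog.
have [|T [f [fP fmin]]] := minimal_approximation fg_fin (I := I).
  (* Finite length over [k] makes [I] finitely generated, so contravariant finiteness applies to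
     it. *)
  have [A [f [/littleP LA fA]]] := cf I (rfinlen_fg I_fin).
  by exists A, f; split=> // B g /littleP; apply: fA.
apply: Fin_dim_le_fin_dim => d M dP /proj_dim_fin[m Mm].
apply: (pdle_finitistic (T := T)) Mm.
- exact: (rfinlen_endo_dcc phi_central (fg_fin _ fP.1.1)).
- exact: (fin_algebra_noetherian k_fin L_gen).
- exact: fP.1.
- exact: (approximation_ext fP fmin I_inj).
- exact: (approximation_cogen fg_fin fP I_cog).
- by move=> C /littleP; apply: dP.
Qed.
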